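(* Let $G$ be a finite group generated by pseudoreflections on $\mathbb{C}^n$, let $\{\theta_i\}_{i=1}^n$ be a homogeneous system of parameters associated to $G$, put $\boldsymbol\theta=(\theta_1,\ldots,\theta_n)$, and let $\Omega\subseteq\mathbb{C}^n$ be a $G$-invariant domain. Then for every $G$-invariant holomorphic function $f$ on $\Omega$ there exists a unique holomorphic function $g$ on $\boldsymbol\theta(\Omega)$ such that $f=g\circ\boldsymbol\theta$ on $\Omega$.
   Context: A pseudoreflection on $\mathbb{C}^n$ is a linear map $\rho:\mathbb{C}^n\to\mathbb{C}^n$ of finite order in $GL(n,\mathbb{C})$ such that $I_n-\rho$ has rank $1$. A domain $\Omega$ is $G$-invariant if $\rho(\Omega)=\Omega$ for all $\rho\in G$; a function $f$ on $\Omega$ is $G$-invariant if $f(\rho^{-1}\boldsymbol z)=f(\boldsymbol z)$ for all $\rho\in G$, $\boldsymbol z\in\Omega$. A homogeneous system of parameters (hsop, or basic polynomials) associated to $G$ is a family $\{\theta_i\}_{i=1}^n$ of algebraically independent homogeneous $G$-invariant polynomials with $\mathbb{C}[\boldsymbol z]^G=\mathbb{C}[\theta_1,\ldots,\theta_n]$, where $\mathbb{C}[\boldsymbol z]^G$ is the ring of $G$-invariant polynomials in $\mathbb{C}[\boldsymbol z]=\mathbb{C}[z_1,\ldots,z_n]$. It is known that $\boldsymbol\theta(\Omega)$ is a domain in $\mathbb{C}^n$. *)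

(* Defs.v *)
From HB Require Import structures.
From mathcomp Require Import all_boot all_order all_algebra complex.
From mathcomp Require Import boolp classical_sets cardinality reals.
From mathcomp Require Import topology normedtype derive.
(* Without its notations, which clash with those of the analysis library. *)
From mathcomp.multinomials Require Import (canonicals, coercions) mpoly.

Set Implicit Arguments.
Unset Strict Implicit.
Unset Printing Implicit Defensive.

Import Order.TTheory GRing.Theory Num.Theory.
Import numFieldNormedType.Exports.

Local Open Scope classical_set_scope.
Local Open Scope ring_scope.

(* The definitions are stated over an arbitrary [C : numClosedFieldType], for
   which the analysis library provides the topology and the normed structure of
   [C] and ['cV[C]_n]; they are meant to be used with [C := R[i]] for
   [R : realType].  A linear map of C^n is a matrix [rho] acting on column
   vectors by [z |-> rho *m z]. *)

Section PseudoreflectionGroups.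
Variables (C : numClosedFieldType) (n : nat).
Implicit Types (rho : 'M[C]_n) (G H S : set 'M[C]_n) (U : set 'cV[C]_n).

Definition GL_subgroup H : Prop :=
  [/\ forall rho, H rho -> rho \in unitmx,
      H 1%:M,
      forall rho sigma, H rho -> H sigma -> H (rho *m sigma)
    & forall rho, H rho -> H (invmx rho)].

Definition pseudoreflection rho : Prop :=
  [/\ rho \in unitmx,
      exists2 k : nat, (0 < k)%N & rho ^+ k = 1
    & \rank (1%:M - rho) = 1%N].

(* [smallest GL_subgroup S] is the intersection of all subgroups of GL(n, C)
   containing [S], that is, the subgroup generated by [S]. *)
Definition finite_pseudoreflection_group G : Prop :=
  finite_set G /\
  exists2 S, (forall rho, S rho -> pseudoreflection rho)
           & G = smallest GL_subgroup S.

Definition domain U : Prop := [/\ U !=set0, open U & connected U].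

Definition invariant_set G U : Prop :=
  forall rho, G rho -> [set rho *m z | z in U] = U.

Definition invariant_fun G U (f : 'cV[C]_n -> C) : Prop :=
  forall rho z, G rho -> U z -> f (invmx rho *m z) = f z.

Definition poly_fun (p : mpoly.mpoly n C) (z : 'cV[C]_n) : C :=
  mpoly.meval (fun i => z i 0) p.

Definition invariant_poly G (p : mpoly.mpoly n C) : Prop :=
  invariant_fun G setT (poly_fun p).

(* [mpoly.comp_mpoly theta q] is q(theta_1, ..., theta_n). *)
Definition hsop G (theta : n.-tuple (mpoly.mpoly n C)) : Prop :=
  [/\ forall i, tnth theta i \is mpoly.ishomog mpoly.mdeg,
      forall i, invariant_poly G (tnth theta i),
      forall q : mpoly.mpoly n C, mpoly.comp_mpoly theta q = 0 -> q = 0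
    & forall p : mpoly.mpoly n C,
        invariant_poly G p <-> exists q, p = mpoly.comp_mpoly theta q].

Definition poly_map (theta : n.-tuple (mpoly.mpoly n C)) (z : 'cV[C]_n) :
    'cV[C]_n :=
  \col_i poly_fun (tnth theta i) z.

(* A function on an open set [U] is represented by a total function of which
   only the values on [U] matter; [differentiable] is Frechet differentiability
   over the field [C], that is, complex differentiability. *)
Definition holomorphic_on U (f : 'cV[C]_n -> C) : Prop :=
  forall z, U z -> differentiable f z.

End PseudoreflectionGroups.

(* Main.v *)
Require Import Defs.
From HB Require Import structures.
From mathcomp Require Import all_boot all_order all_algebra complex.
From mathcomp Require Import boolp classical_sets functions cardinality reals.
From mathcomp Require Import interval_inference.
From mathcomp Require Import topology normedtype landau derive.
From mathcomp.multinomials Require Import (canonicals, coercions) mpoly.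
From mathcomp Require Import ring lra zify.

(** The function [g] is forced: [g (theta z) = f z]. It is well defined because
    [theta] separates orbits ([orbit_map_separates]), and what has to be shown is
    that it is complex differentiable at a point [w0 = theta z0]. Let [N] be the
    order of the group.

    The point is that [f] agrees to order [2 N] at [z0] with an invariant
    polynomial ([invariant_poly_approx]): take a Taylor polynomial of [f] at [z0],
    multiply it by a polynomial that is 1 to high order at [z0] and 0 to high
    order at the other points of its orbit, and average over the group. The
    invariant polynomial is [q(theta)] for some polynomial [q]. On the other hand
    [theta] is onto ([orbit_map_surjective]), and every [w] near [w0] is
    [theta z] for some [z] with [|z - z0| ^ N] at most a multiple of [|w - w0|]
    ([orbit_map_hoelder]). Hence [g w - q w = f z - q(theta z)] is of order
    [|z - z0| ^ (2 N)], that is, of order [|w - w0| ^ 2], and [g] is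
    differentiable at [w0] because [q] is.

    Hoelder estimate. For a linear form [l] the polynomial
    [prod_rho l (z0 - rho z)] is invariant in [z] and vanishes at [z0], so it is a
    polynomial in [theta z] that is at most a multiple of [|theta z - theta z0|].
    Among finitely many forms [l] there is always one for which
    [|l (z0 - rho z)|] is comparable to [|z0 - rho z|] for all [rho]
    ([generic_linform]); the smallest factor is then bounded as claimed.

    Surjectivity. Averaging over the group and algebraic independence show that
    the ideal generated by the [theta i - w i] is proper
    ([fibre_ideal_proper]); each coordinate is integral over the invariants
    ([fibre_ideal_split]), so the ideal has a zero ([common_zero]).

    Taylor polynomials ([sephol_poly_approx]). Holomorphy means differentiability
    at each point, so one-variable function theory is developed from Goursat's
    lemma. Contour integrals over squares are replaced by finite Riemann sums that
    are exact on affine functions ([goursat]); they give Cauchy's formula up to a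
    constant ([mean_weak]), and applying it to powers removes the constant and
    allows exceptional points ([mean_ineq]). Applied to divided differences this
    yields Cauchy's estimates ([hol_divided_diff]), hence removable singularities
    ([hol_limit_cdiff]), hence division of [f - f(z with z_i = 0)] by [z_i]. *)

Set Implicit Arguments.
Unset Strict Implicit.
Unset Printing Implicit Defensive.

Import Order.TTheory GRing.Theory Num.Theory.
Import numFieldNormedType.Exports.

Local Open Scope classical_set_scope.
Local Open Scope ring_scope.
Local Open Scope complex_scope.

Local Notation Re := complex.Re.
Local Notation Im := complex.Im.


(** * The modulus of a complex number, as a real number *)

Section Modulus.
Variable R : realType.
Implicit Types (x y z : R[i]) (r : R).

Definition nm z : R := ComplexField.Normc.normc z.

Lemma normE z : `|z| = (nm z)%:C.
Proof. by []. Qed.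

Lemma nm_ge0 z : 0 <= nm z.
Proof. by case: z => a b; apply: sqrtr_ge0. Qed.

Lemma nm0 : nm 0 = 0.
Proof. exact: ComplexField.Normc.normc0. Qed.

Lemma nm1 : nm 1 = 1.
Proof. exact: ComplexField.Normc.normc1. Qed.

Lemma nm0_eq0 z : nm z = 0 -> z = 0.
Proof. exact: ComplexField.Normc.eq0_normc. Qed.

Lemma nm_eq0 z : (nm z == 0) = (z == 0).
Proof. by apply/eqP/eqP => [/nm0_eq0 //|->]; rewrite nm0. Qed.

Lemma nm_gt0 z : (0 < nm z) = (z != 0).
Proof. by rewrite lt0r nm_ge0 andbT nm_eq0. Qed.

Lemma nmM x y : nm (x * y) = nm x * nm y.
Proof. exact: ComplexField.Normc.normcM. Qed.

Lemma nmV x : nm x^-1 = (nm x)^-1.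
Proof. exact: ComplexField.Normc.normcV. Qed.

Lemma nmX x k : nm (x ^+ k) = nm x ^+ k.
Proof. by elim: k => [|k IH]; rewrite ?expr0 ?nm1 // !exprS nmM IH. Qed.

Lemma nmD x y : nm (x + y) <= nm x + nm y.
Proof. exact: le_normcD. Qed.

Lemma nmN x : nm (- x) = nm x.
Proof. exact: normcN. Qed.

Lemma nmB x y : nm (x - y) <= nm x + nm y.
Proof. by rewrite -(nmN y) nmD. Qed.

Lemma nm_distC x y : nm (x - y) = nm (y - x).
Proof. by rewrite -nmN opprB. Qed.

Lemma nm_tri y x z : nm (x - z) <= nm (x - y) + nm (y - z).
Proof. by have := nmD (x - y) (y - z); rewrite addrA subrK. Qed.

Lemma nm_real r : nm r%:C = `|r|.
Proof. by rewrite /nm /= expr0n addr0 sqrtr_sqr. Qed.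

Lemma nm_nat k : nm k%:R = k%:R.
Proof. by rewrite -(rmorph_nat (real_complex R)) nm_real normr_nat. Qed.

Lemma nm_i : nm (0 +i* 1) = 1.
Proof. by rewrite /nm /= expr0n add0r expr1n sqrtr1. Qed.

Lemma Re_le_nm z : `|Re z| <= nm z.
Proof. by have := normc_ge_Re z; rewrite normE lecR. Qed.

Lemma Im_le_nm z : `|Im z| <= nm z.
Proof.
have := Re_le_nm (z * (0 +i* 1)); rewrite nmM nm_i mulr1.
by case: z => a b /=; rewrite mulr0 mulr1 add0r normrN.
Qed.

Lemma nm_sqr z : nm z ^+ 2 = Re z ^+ 2 + Im z ^+ 2.
Proof. by case: z => a b; rewrite sqr_sqrtr // addr_ge0 // sqr_ge0. Qed.

Lemma nm_le_Re_Im z : nm z <= `|Re z| + `|Im z|.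
Proof.
rewrite {1}(complexE z); apply: (le_trans (nmD _ _)).
by rewrite nmM nm_i mul1r !nm_real.
Qed.

Lemma nm_sum (I : Type) (s : seq I) (P : pred I) (F : I -> R[i]) :
  nm (\sum_(i <- s | P i) F i) <= \sum_(i <- s | P i) nm (F i).
Proof.
elim/big_rec2: _ => [|i y x _ IH]; first by rewrite nm0.
by apply: (le_trans (nmD _ _)); rewrite lerD2l.
Qed.

Lemma nm_prod (I : Type) (s : seq I) (P : pred I) (F : I -> R[i]) :
  nm (\prod_(i <- s | P i) F i) = \prod_(i <- s | P i) nm (F i).
Proof. by elim/big_rec2: _ => [|i y x _ IH]; rewrite ?nm1 // nmM IH. Qed.

End Modulus.
Arguments nm : simpl never.

(** * Discrete contour sums and Goursat's lemma *)

Section Goursat.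
Variable R : realType.
Local Notation C := R[i].
Implicit Types (F G : C -> C) (a p z : C) (s h e : R) (n N : nat).

Definition cdiff F p := exists d, forall e, 0 < e ->
  exists2 del, 0 < del &
    forall t, nm t < del -> nm (F (p + t) - F p - d * t) <= e * nm t.

Definition pt a h (j k : nat) : C := a + (h * j%:R +i* (h * k%:R)).

(** Left Riemann sums of [F] along the four edges of the square of side [h N]
    with lower left corner [a], divided by [h]; both horizontal edges, and both
    vertical ones, are sampled at corresponding points. *)
Definition csum F a h N : C :=
  \sum_(j < N) (F (pt a h j 0) - F (pt a h j N)
                + (0 +i* 1) * (F (pt a h N j) - F (pt a h 0 j))).

Definition contour F a s n : C := (s / 2 ^+ n)%:C * csum F a (s / 2 ^+ n) (2 ^ n).

Definition in_square a s z :=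
  (0 <= Re (z - a) <= s) && (0 <= Im (z - a) <= s).

Definition on_edge a s z :=
  in_square a s z && [|| Re (z - a) == 0, Re (z - a) == s,
                         Im (z - a) == 0 | Im (z - a) == s].

Lemma ptpt a h i j k l : pt (pt a h i j) h k l = pt a h (i + k) (j + l).
Proof.
by rewrite /pt -addrA; congr (a + _); simpc; rewrite -!mulrDr -!natrD.
Qed.

Lemma csum_split F a h N : csum F a h (N + N) =
  csum F a h N + csum F (pt a h N 0) h N
  + csum F (pt a h 0 N) h N + csum F (pt a h N N) h N.
Proof.
rewrite /csum big_split_ord /= -!big_split /=; apply: eq_bigr => j _.
rewrite !ptpt !addn0 !add0n; move: (0 +i* 1) => u; ring.
Qed.

Lemma half_pow s n : s / 2 ^+ n.+1 = s / 2 / 2 ^+ n.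
Proof. by rewrite exprS invfM mulrA. Qed.

Lemma contour_split F a s n : contour F a s n.+1 =
  contour F a (s / 2) n + contour F (a + (s / 2 +i* 0)) (s / 2) n
  + contour F (a + (0 +i* (s / 2))) (s / 2) n
  + contour F (a + (s / 2 +i* (s / 2))) (s / 2) n.
Proof.
rewrite /contour half_pow; set h := s / 2 / 2 ^+ n.
have hN : h * (2 ^ n)%:R = s / 2 by rewrite natrX mulfVK // expf_neq0 // pnatr_eq0.
by rewrite expnS mul2n -addnn csum_split -!mulrDr /pt !mulr0n !mulr0 hN.
Qed.

Lemma csumD F G a h N :
  csum (fun z => F z + G z) a h N = csum F a h N + csum G a h N.
Proof. by rewrite /csum -big_split; apply: eq_bigr => j _ /=; move: (0 +i* 1) => u; ring. Qed.

Lemma csumZ c F a h N : csum (fun z => c * F z) a h N = c * csum F a h N.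
Proof. by rewrite /csum mulr_sumr; apply: eq_bigr => j _ /=; move: (0 +i* 1) => u; ring. Qed.

Lemma contourD F G a s n :
  contour (fun z => F z + G z) a s n = contour F a s n + contour G a s n.
Proof. by rewrite /contour csumD mulrDr. Qed.

Lemma contourZ c F a s n :
  contour (fun z => c * F z) a s n = c * contour F a s n.
Proof. by rewrite /contour csumZ mulrCA. Qed.

(** Left Riemann sums on opposite edges use points that differ by a constant
    translation, so affine functions integrate to 0 exactly. *)
Lemma contour_affine (b d : C) a s n : contour (fun z => b + d * z) a s n = 0.
Proof.
rewrite /contour /csum big1 ?mulr0 // => j _ /=.
rewrite /pt; set h := s / _; set u := (2 ^ n)%:R; rewrite !mulr0n.
have -> : (h * j%:R +i* (h * u)) = (h * j%:R +i* (h * 0)) + (0 +i* 1) * (h * u)%:C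
   :> C.
  by simpc.
have -> : (h * u +i* (h * j%:R)) = (h * 0 +i* (h * j%:R)) + (h * u)%:C :> C.
  by simpc.
move: (0 +i* 1) => u'; ring.
Qed.

Lemma on_edge_pt a s n (j : 'I_(2 ^ n)) (h := s / 2 ^+ n) : 0 <= s ->
  [/\ on_edge a s (pt a h j 0), on_edge a s (pt a h j (2 ^ n)),
      on_edge a s (pt a h (2 ^ n) j) & on_edge a s (pt a h 0 j)].
Proof.
move=> s0; have hN : h * (2 ^ n)%:R = s by rewrite natrX mulfVK // expf_neq0 // pnatr_eq0.
have h0 : 0 <= h by rewrite divr_ge0 // exprn_ge0.
have hj : 0 <= h * j%:R <= s.
  by rewrite mulr_ge0 //= -hN ler_wpM2l // ler_nat ltnW.
rewrite /on_edge /in_square /pt !mulr0n !hN !mulr0 !(addrC a) !addrK /=.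
by rewrite hj !lexx !s0 !eqxx !orbT.
Qed.

Lemma eq_contour F G a s n : 0 <= s ->
  (forall z, on_edge a s z -> F z = G z) -> contour F a s n = contour G a s n.
Proof.
move=> s0 FG; rewrite /contour /csum; congr (_ * _); apply: eq_bigr => j _.
by have [? ? ? ?] := on_edge_pt a j s0; rewrite !FG.
Qed.

Lemma contour_bound F a s n K : 0 <= s ->
  (forall z, on_edge a s z -> nm (F z) <= K) ->
  nm (contour F a s n) <= 4 * K * s.
Proof.
move=> s0 FK; rewrite /contour nmM nm_real ger0_norm; last first.
  by rewrite divr_ge0 // exprn_ge0.
have : nm (csum F a (s / 2 ^+ n) (2 ^ n)) <= \sum_(j < 2 ^ n) (4 * K).
  apply: (le_trans (nm_sum _ _ _)); apply: ler_sum => j _.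
  have [/FK p1 /FK p2 /FK p3 /FK p4] := on_edge_pt a j s0.
  apply: (le_trans (nmD _ _)); rewrite nmM nm_i mul1r.
  apply: (le_trans (lerD (nmB _ _) (nmB _ _))); lra.
rewrite sumr_const card_ord -[_ *+ (2 ^ n)]mulr_natl natrX => le.
have p2 : 0 < 2 ^+ n :> R by rewrite exprn_gt0.
apply: (le_trans (ler_wpM2l _ le)); first by rewrite divr_ge0 // ltW.
by rewrite [leLHS](_ : _ = 4 * K * s) //; field; rewrite gt_eqF.
Qed.


Definition eventually_le (u : nat -> C) e :=
  exists n0, forall n, (n0 <= n)%N -> nm (u n) <= e.

Lemma eventually_le_split (u u1 u2 u3 u4 : nat -> C) e1 e2 e3 e4 e :
  (forall n, u n.+1 = u1 n + u2 n + u3 n + u4 n) ->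
  eventually_le u1 e1 -> eventually_le u2 e2 ->
  eventually_le u3 e3 -> eventually_le u4 e4 ->
  e1 + e2 + e3 + e4 <= e -> eventually_le u e.
Proof.
move=> uS [n1 h1] [n2 h2] [n3 h3] [n4 h4] he.
exists (n1 + n2 + n3 + n4).+1 => -[//|n]; rewrite ltnS => hn.
have [l1 l2 l3 l4] : [/\ (n1 <= n)%N, (n2 <= n)%N, (n3 <= n)%N & (n4 <= n)%N].
  by split; apply: leq_trans hn; rewrite -?addnA; lia.
rewrite uS.
have := h1 n l1; have := h2 n l2; have := h3 n l3; have := h4 n l4.
have := nmD (u1 n + u2 n + u3 n) (u4 n).
have := nmD (u1 n + u2 n) (u3 n); have := nmD (u1 n) (u2 n); lra.
Qed.

Lemma in_squareP a s z : reflect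
  ((0 <= Re z - Re a <= s) /\ (0 <= Im z - Im a <= s)) (in_square a s z).
Proof. by case: a z => [a1 a2] [z1 z2]; apply: (iffP andP). Qed.

Lemma nm_in_square a s p z : in_square a s p -> in_square a s z ->
  nm (z - p) <= 2 * s.
Proof.
move=> /in_squareP[/andP[p1 p2] /andP[p3 p4]] /in_squareP[/andP[z1 z2] /andP[z3 z4]].
apply: (le_trans (nm_le_Re_Im _)).
have -> : Re (z - p) = Re z - Re p by case: (z) (p) => [? ?] [? ?].
have -> : Im (z - p) = Im z - Im p by case: (z) (p) => [? ?] [? ?].
have : `|Re z - Re p| <= s by rewrite ler_norml; apply/andP; split; lra.
have : `|Im z - Im p| <= s by rewrite ler_norml; apply/andP; split; lra.
lra.
Qed.

(** Subtracting an affine function does not change the contour sum, and the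
    remainder of [F] at [p] is small compared with the side of the square. *)
Lemma contour_near F p e : cdiff F p -> 0 < e ->
  exists2 del, 0 < del & forall a s n, 0 <= s -> s < del ->
    in_square a s p -> nm (contour F a s n) <= e * s ^+ 2.
Proof.
move=> [d Fd] e0; have [|del del0 Hd] := Fd (e / 8); first lra.
exists (del / 2); first lra.
move=> a s n s0 sdel pin.
pose E z := F z - F p - d * (z - p).
have -> : contour F a s n = contour E a s n.
  rewrite -[LHS]subr0 -(contour_affine (F p - d * p) d a s n).
  rewrite -mulN1r -contourZ -contourD; apply: eq_contour => // z _.
  by rewrite /E; ring.
apply: (le_trans (contour_bound (K := e / 8 * (2 * s)) _ s0 _)); last first.
  by rewrite expr2 le_eqVlt; apply/orP; left; apply/eqP; field.
move=> z /andP[zin _]; have zp := nm_in_square pin zin.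
have := Hd (z - p); rewrite subrKC => /(_ _) h.
apply: (le_trans (h _)); first by apply: le_lt_trans zp _; lra.
by rewrite ler_wpM2l //; lra.
Qed.

Section Bisection.
Variable bad : C -> R -> Prop.
Hypothesis bad_split : forall a s, bad a s ->
  exists bc : bool * bool,
    bad (a + (bc.1%:R * (s / 2) +i* (bc.2%:R * (s / 2)))) (s / 2).
Variables (a0 : C) (s0 : R).
Hypotheses (s0_ge0 : 0 <= s0) (bad0 : bad a0 s0).

(** Nested bad squares shrink to a point: the real and imaginary parts of that
    point are the suprema of those of the lower left corners. *)
Lemma bisection : exists2 p, in_square a0 s0 p &
  forall k, exists a, [/\ bad a (s0 / 2 ^+ k) & in_square a (s0 / 2 ^+ k) p].
Proof.
have /choice[g gP] : forall x : C * R, exists bc : bool * bool,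
    bad x.1 x.2 ->
    bad (x.1 + (bc.1%:R * (x.2 / 2) +i* (bc.2%:R * (x.2 / 2)))) (x.2 / 2).
  move=> [a s]; have [/bad_split[bc h]|h] := pselect (bad a s); first by exists bc.
  by exists (true, true).
pose f (x : C * R) : C * R :=
  (x.1 + ((g x).1%:R * (x.2 / 2) +i* ((g x).2%:R * (x.2 / 2))), x.2 / 2).
pose u k := (iter k f (a0, s0)).1; pose s k := s0 / 2 ^+ k.
have uE k : iter k f (a0, s0) = (u k, s k).
  rewrite [LHS]surjective_pairing; congr pair; rewrite /s.
  by elim: k => [|k IH] /=; rewrite ?expr0 ?divr1 // IH exprS invfM; ring.
have uS k : u k.+1 = u k + ((g (u k, s k)).1%:R * s k.+1 +i* ((g (u k, s k)).2%:R * s k.+1)).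
  by rewrite {1}/u /= uE /= /s half_pow mulrAC.
have sS k : s k = s k.+1 + s k.+1 by rewrite /s half_pow mulrAC; lra.
have s_ge0 k : 0 <= s k by rewrite divr_ge0 // exprn_ge0.
have ubad k : bad (u k) (s k).
  elim: k => [|k IH]; first by rewrite /u /s /= expr0 divr1.
  by rewrite uS; have := gP (u k, s k) IH; rewrite /= /s half_pow mulrAC.
have b01 (b : bool) (x : R) : 0 <= x -> 0 <= b%:R * x <= x.
  by case: b => x0; rewrite ?mul1r ?mul0r lexx ?x0.
have lim (v : nat -> R) : (forall k, 0 <= v k.+1 - v k <= s k.+1) ->
    exists x, forall k, 0 <= x - v k <= s k.
  move=> vS.
  have vm k m : v k <= v (k + m)%N <= v k + s k - s (k + m)%N.
    elim: m => [|m IH]; first by rewrite addn0 lexx /=; lra.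
    rewrite addnS; have := vS (k + m)%N; have := sS (k + m)%N; move: IH; lra.
  have ub k : ubound (range v) (v k + s k).
    move=> _ [m _ <-]; have [km|mk] := leqP k m.
      by have := vm k (m - k)%N; rewrite subnKC //; have := s_ge0 m; lra.
    have := vm m (k - m)%N; rewrite subnKC 1?ltnW //; have := s_ge0 k; lra.
  have hs : has_sup (range v).
    by split; [exists (v 0%N), 0%N | exists (v 0%N + s 0%N); apply: ub].
  exists (sup (range v)) => k; apply/andP; split.
    by rewrite subr_ge0; apply: ub_le_sup; [case: hs | exists k].
  by rewrite lerBlDl; apply: ge_sup; [case: hs | apply: ub].
have uSR k : Re (u k.+1) = Re (u k) + (g (u k, s k)).1%:R * s k.+1.
  by rewrite uS; case: (u k).
have uSI k : Im (u k.+1) = Im (u k) + (g (u k, s k)).2%:R * s k.+1.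
  by rewrite uS; case: (u k).
have [|x xP] := lim (fun k => Re (u k)).
  by move=> k; rewrite uSR addrC addKr; apply: b01.
have [|y yP] := lim (fun k => Im (u k)).
  by move=> k; rewrite uSI addrC addKr; apply: b01.
have pin k : in_square (u k) (s k) (x +i* y).
  by apply/in_squareP; split; [apply: xP | apply: yP].
exists (x +i* y); first by have := pin 0%N; rewrite /s expr0 divr1.
by move=> k; exists (u k).
Qed.

End Bisection.

(** A square on which the contour sums stay large compared with its area has a
    quarter with the same property; the nested squares shrink to a point, where
    this contradicts [contour_near]. *)
Theorem goursat F a s e : 0 <= s -> 0 < e ->
  (forall z, in_square a s z -> cdiff F z) -> eventually_le (contour F a s) e.
Proof.
move=> s0 e0 Fd; pose c := e / (s ^+ 2 + 1).
have s21 : 0 < s ^+ 2 + 1 by rewrite ltr_wpDl // sqr_ge0.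
have c0 : 0 < c by rewrite divr_gt0.
have cs : c * s ^+ 2 <= e.
  rewrite /c mulrAC ler_pdivrMr //; nra.
pose bad a s := ~ eventually_le (contour F a s) (c * s ^+ 2).
suff [n0 Hn] : eventually_le (contour F a s) (c * s ^+ 2).
  by exists n0 => n /Hn h; apply: le_trans cs.
apply: contrapT => bad0.
have badS b t : bad b t -> exists bc : bool * bool,
    bad (b + (bc.1%:R * (t / 2) +i* (bc.2%:R * (t / 2)))) (t / 2).
  move=> bb; apply: contrapT => nbad; apply: bb.
  have good (bc : bool * bool) : eventually_le
      (contour F (b + (bc.1%:R * (t / 2) +i* (bc.2%:R * (t / 2)))) (t / 2))
      (c * (t / 2) ^+ 2).
    by apply: contrapT => h; apply: nbad; exists bc.
  have := good (false, false); have := good (true, false).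
  have := good (false, true); have := good (true, true).
  rewrite /= !mul1r !mul0r addr0 => g4 g3 g2 g1.
  apply: (eventually_le_split (contour_split F b t) g1 g2 g3 g4).
  by rewrite le_eqVlt; apply/orP; left; apply/eqP; field.
have [p pin near] := bisection badS s0 bad0.
have [del del0 small] := contour_near (Fd p pin) c0.
have [k sk] : exists k, s / 2 ^+ k < del.
  exists (Num.bound (s / del)); rewrite ltr_pdivrMr ?exprn_gt0 // mulrC.
  by rewrite -ltr_pdivrMr // upper_nthrootP.
have [b [bb pb]] := near k; apply: bb; exists 0%N => n _.
by apply: small => //; rewrite divr_ge0 // exprn_ge0.
Qed.

(** The position of an exceptional point that stays away from the grid lines
    under bisection: one third or two thirds of the way along the diagonal. *)
Definition at_third a s c :=
  c = a + (s / 3 +i* (s / 3)) \/ c = a + (2 * s / 3 +i* (2 * s / 3)).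

(** A bounded function may fail to be differentiable at one such point: at each
    step three of the four subsquares avoid it, and the fourth one becomes so
    small that the trivial bound suffices. *)
Lemma goursat_puncture F a s c K e : 0 < s -> 0 < e -> at_third a s c ->
  (forall z, in_square a s z -> z != c -> cdiff F z) ->
  (forall z, in_square a s z -> nm (F z) <= K) ->
  eventually_le (contour F a s) e.
Proof.
move=> s0 e0 ct Fd FK.
suff claim m : forall b t eta, 0 < t -> 0 < eta -> at_third b t c ->
    (forall z, in_square b t z -> in_square a s z) -> 4 * K * t <= 2 ^+ m * (e / 2) ->
    eventually_le (contour F b t) (e / 2 + eta).
  have e20 : 0 < e / 2 by lra.
  pose m := Num.bound (4 * K * s / (e / 2)).
  have mP : 4 * K * s <= 2 ^+ m * (e / 2).
    by rewrite -ler_pdivrMr //; apply/ltW/upper_nthrootP.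
  have [n0 Hn] := claim m a s (e / 2) s0 e20 ct (fun=> id) mP.
  by exists n0 => n /Hn; lra.
elim: m => [|m IH] b t eta t0 eta0 bt sub_a Kt.
  exists 0%N => n _; apply: (le_trans (contour_bound (K := K) _ (ltW t0) _)).
    by move=> z /andP[/sub_a /FK].
  by move: Kt; rewrite expr0; lra.
pose q (x y : bool) := b + (x%:R * (t / 2) +i* (y%:R * (t / 2))).
have subq x y z : in_square (q x y) (t / 2) z -> in_square b t z.
  rewrite /q; case: (b) => b1 b2 /in_squareP zin; apply/in_squareP.
  by move: zin; case: x; case: y; rewrite /= ?mul0r ?mul1r; lra.
have good x y : ~~ in_square (q x y) (t / 2) c ->
    eventually_le (contour F (q x y) (t / 2)) (eta / 6).
  move=> nc; apply: goursat; [lra|lra|move=> z zin; apply: Fd; first by apply/sub_a/(subq x y)].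
  by apply: contraNneq nc => <-.
have step x y : at_third (q x y) (t / 2) c ->
    eventually_le (contour F (q x y) (t / 2)) (e / 2 + eta / 2).
  move=> h; apply: IH => //; try lra; first by move=> z /subq /sub_a.
  by move: Kt; rewrite exprS; lra.
have qE x y : q x y = b + (x%:R * (t / 2) +i* (y%:R * (t / 2))) by [].
have split4 n : contour F b t n.+1 = contour F (q false false) (t / 2) n
    + contour F (q true false) (t / 2) n + contour F (q false true) (t / 2) n
    + contour F (q true true) (t / 2) n.
  by rewrite contour_split /q /= !mul0r !mul1r addr0.
have notin x y : (if x then Re c < Re b + t / 2 else Re b + t / 2 < Re c) ->
    ~~ in_square (q x y) (t / 2) c.
  rewrite /q => xc; apply/negP => /in_squareP; move: xc.
  by case: (b) => b1 b2; case: x; rewrite /= ?mul0r ?mul1r; lra.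
have notin' x y : (if y then Im c < Im b + t / 2 else Im b + t / 2 < Im c) ->
    ~~ in_square (q x y) (t / 2) c.
  rewrite /q => xc; apply/negP => /in_squareP; move: xc.
  by case: (b) => b1 b2; case: y; rewrite /= ?mul0r ?mul1r; lra.
case: bt => cE.
  have [h1 h2] : Re c < Re b + t / 2 /\ Im c < Im b + t / 2.
    by rewrite cE; case: (b) => b1 b2 /=; split; lra.
  apply: (eventually_le_split split4 (step false false _) (good true false _)
    (good false true _) (good true true _)).
  - right; rewrite cE qE /= !mul0r addr0; congr (_ + _).
    by apply/eqP; rewrite eq_complex /=; apply/andP; split; apply/eqP; field.
  - exact (notin true false h1).
  - exact (notin' false true h2).
  - exact (notin true true h1).
  - lra.
have [h1 h2] : Re b + t / 2 < Re c /\ Im b + t / 2 < Im c.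
  by rewrite cE; case: (b) => b1 b2 /=; split; lra.
apply: (eventually_le_split split4 (good false false _) (good true false _)
  (good false true _) (step true true _)).
- exact (notin false false h1).
- exact (notin' true false h2).
- exact (notin false true h1).
- left; rewrite cE qE /= !mul1r -addrA; congr (_ + _).
  by apply/eqP; rewrite eq_complex /=; apply/andP; split; apply/eqP; field.
- lra.
Qed.


End Goursat.

(** * Complex differentiability in one variable *)

Section CDiff.
Variable R : realType.
Local Notation C := R[i].
Implicit Types (F G : C -> C) (p z : C).

Definition ccont F p := forall e, 0 < e -> exists2 del, 0 < del &
  forall t, nm t < del -> nm (F (p + t) - F p) <= e.

Lemma ccont_cst c p : ccont (fun=> c) p.
Proof. by move=> e e0; exists 1 => // t _; rewrite subrr nm0 ltW. Qed.

Lemma ccont_id p : ccont id p.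
Proof. by move=> e e0; exists e => // t; rewrite addrC addKr => /ltW. Qed.

Lemma ccontD F G p : ccont F p -> ccont G p -> ccont (fun z => F z + G z) p.
Proof.
move=> Fc Gc e e0; have e2 : 0 < e / 2 by lra.
have [d1 d10 H1] := Fc _ e2; have [d2 d20 H2] := Gc _ e2.
exists (Num.min d1 d2) => [|t]; first by rewrite lt_min d10.
rewrite lt_min => /andP[/H1 h1 /H2 h2].
rewrite [X in nm X](_ : _ = (F (p + t) - F p) + (G (p + t) - G p)); last by ring.
by apply: (le_trans (nmD _ _)); lra.
Qed.

Lemma ccontN F p : ccont F p -> ccont (fun z => - F z) p.
Proof.
move=> Fc e /Fc[d d0 H]; exists d => // t /H.
by rewrite -opprD nmN.
Qed.

Lemma ccontM F G p : ccont F p -> ccont G p -> ccont (fun z => F z * G z) p.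
Proof.
move=> Fc Gc e e0.
have f0 := nm_ge0 (F p); have g0 := nm_ge0 (G p).
have e1 : 0 < e / (2 * (nm (G p) + 1)) by rewrite divr_gt0 //; lra.
have e2 : 0 < e / (2 * (nm (F p) + 1)) by rewrite divr_gt0 //; lra.
have [d1 d10 H1] := Fc _ e1; have [d2 d20 H2] := Gc _ e2; have [d3 d30 H3] := Gc _ ltr01.
exists (Num.min d1 (Num.min d2 d3)) => [|t]; first by rewrite !lt_min d10 d20.
rewrite !lt_min => /and3P[/H1 h1 /H2 h2 /H3 h3].
move: h1 h2; rewrite !ler_pdivlMr; [|lra|lra] => h1 h2.
rewrite [X in nm X](_ : _ = (F (p + t) - F p) * G (p + t)
  + F p * (G (p + t) - G p)); last by ring.
apply: (le_trans (nmD _ _)); rewrite !nmM.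
have := nmD (G (p + t) - G p) (G p); rewrite subrK => h4.
have n1 := nm_ge0 (F (p + t) - F p); have n2 := nm_ge0 (G (p + t) - G p).
have h5 : nm (F (p + t) - F p) * nm (G (p + t)) <= nm (F (p + t) - F p) * (nm (G p) + 1).
  by rewrite ler_wpM2l //; lra.
have h6 : nm (F p) * nm (G (p + t) - G p) <= (nm (F p) + 1) * nm (G (p + t) - G p).
  by rewrite ler_wpM2r //; lra.
lra.
Qed.

Lemma ccontV F p : F p != 0 -> ccont F p -> ccont (fun z => (F z)^-1) p.
Proof.
move=> Fp Fc e e0; have f0 : 0 < nm (F p) by rewrite nm_gt0.
have e1 : 0 < nm (F p) / 2 by lra.
have e2 : 0 < e * nm (F p) ^+ 2 / 2 by rewrite divr_gt0 // mulr_gt0 // exprn_gt0.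
have [d1 d10 H1] := Fc _ e1; have [d2 d20 H2] := Fc _ e2.
exists (Num.min d1 d2) => [|t]; first by rewrite lt_min d10.
rewrite lt_min => /andP[/H1 h1 /H2 h2].
have := nmD (F p - F (p + t)) (F (p + t)); rewrite subrK nm_distC => h3.
have f1 : 0 < nm (F (p + t)) by lra.
rewrite [X in nm X](_ : _ = - (F (p + t) - F p) / (F (p + t) * F p)); last first.
  by field; rewrite Fp -nm_gt0.
rewrite nmM nmN nmV nmM ler_pdivrMr ?mulr_gt0 //; apply: (le_trans h2).
have h4 : nm (F p) / 2 <= nm (F (p + t)) by lra.
have := ler_wpM2l (ltW (mulr_gt0 e0 f0)) h4; lra.
Qed.

(** Caratheodory's form of differentiability, which turns the rules for products
    and inverses into statements on continuous functions. *)
Lemma cdiffP F p : cdiff F p <->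
  exists2 phi : C -> C, ccont phi p & forall z, F z = F p + phi z * (z - p).
Proof.
split=> [[d Fd]|[phi phic FE]].
  pose phi z := if z == p then d else (F z - F p) / (z - p).
  exists phi => [|z]; last first.
    rewrite /phi; have [->|zp] := eqVneq z p; first by rewrite subrr mulr0 addr0.
    by rewrite mulfVK ?subrKC // subr_eq0.
  move=> e e0; have [del del0 H] := Fd e e0; exists del => // t /H.
  rewrite /phi eqxx (addrC p t) addrK -subr_eq0 addrK.
  have [->|t0 h] := eqVneq t 0; first by rewrite subrr nm0 (ltW e0).
  rewrite -(ler_pM2r (x := nm t)) ?nm_gt0 // -nmM.
  by rewrite mulrBl mulfVK.
exists (phi p) => e e0; have [del del0 H] := phic e e0; exists del => // t /H h.
have -> : F (p + t) - F p - phi p * t = (phi (p + t) - phi p) * t.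
  by rewrite (FE (p + t)); ring.
by rewrite nmM ler_wpM2r // nm_ge0.
Qed.

Lemma cdiff_continuous F p : cdiff F p -> ccont F p.
Proof.
move=> /cdiffP[phi phic FE].
rewrite (_ : F = fun z => F p + phi z * (z - p)); last by apply: funext.
apply: ccontD; first exact: ccont_cst.
by apply: ccontM => //; apply: ccontD; [apply: ccont_id | apply: ccont_cst].
Qed.

Lemma cdiff_cst c p : cdiff (fun=> c) p.
Proof.
by apply/cdiffP; exists (fun=> 0) => [|z]; [apply: ccont_cst | rewrite mul0r addr0].
Qed.

Lemma cdiff_id p : cdiff id p.
Proof.
by apply/cdiffP; exists (fun=> 1) => [|z]; [apply: ccont_cst | rewrite mul1r subrKC].
Qed.

Lemma cdiffD F G p : cdiff F p -> cdiff G p -> cdiff (fun z => F z + G z) p.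
Proof.
move=> /cdiffP[phi phic FE] /cdiffP[psi psic GE]; apply/cdiffP.
exists (fun z => phi z + psi z) => [|z]; first exact: ccontD.
by rewrite {1}FE {1}GE; ring.
Qed.

Lemma cdiffM F G p : cdiff F p -> cdiff G p -> cdiff (fun z => F z * G z) p.
Proof.
move=> Fd Gd; have Gc := cdiff_continuous Gd.
move: Fd Gd => /cdiffP[phi phic FE] /cdiffP[psi psic GE]; apply/cdiffP.
exists (fun z => phi z * G z + F p * psi z) => [|z].
  by apply: ccontD; apply: ccontM => //; apply: ccont_cst.
by rewrite (FE z) mulrDl {1}(GE z); ring.
Qed.

Lemma cdiffN F p : cdiff F p -> cdiff (fun z => - F z) p.
Proof.
move=> Fd; rewrite (_ : (fun z => _) = fun z => (-1) * F z).
  by apply: cdiffM => //; apply: cdiff_cst.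
by apply: funext => z; rewrite mulN1r.
Qed.

Lemma cdiffB F G p : cdiff F p -> cdiff G p -> cdiff (fun z => F z - G z) p.
Proof. by move=> Fd /cdiffN; apply: cdiffD. Qed.

Lemma cdiff_local F G p r : 0 < r -> (forall z, nm (z - p) < r -> F z = G z) ->
  cdiff F p -> cdiff G p.
Proof.
move=> r0 FG [d Fd]; exists d => e e0; have [del del0 H] := Fd e e0.
exists (Num.min r del) => [|t]; first by rewrite lt_min r0.
rewrite lt_min => /andP[tr /H] h.
have e1 : F (p + t) = G (p + t) by apply: FG; rewrite [p + t]addrC addrK.
have e2 : F p = G p by apply: FG; rewrite subrr nm0.
by rewrite -e1 -e2.
Qed.

Lemma cdiffV F p : cdiff F p -> F p != 0 -> cdiff (fun z => (F z)^-1) p.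
Proof.
move=> Fd Fp; have Fc := cdiff_continuous Fd.
move: Fd => /cdiffP[phi phic FE].
have Fp0 : 0 < nm (F p) / 2 by rewrite divr_gt0 ?nm_gt0.
have [r r0 rF] := Fc _ Fp0.
apply: (@cdiff_local (fun z => (F p)^-1 + - (phi z * (F z)^-1) * (F p)^-1 * (z - p)) _ _ r) => //.
  move=> z /rF; rewrite subrKC => h.
  have Fz : F z != 0.
    apply: contraTneq h => ->; rewrite sub0r nmN -ltNge; move: Fp0; lra.
  have xy : phi z * (z - p) = F z - F p by rewrite (FE z) [F p + _]addrC addrK.
  move: (z - p) (phi z) xy => x y xy.
  have -> : - (y * (F z)^-1) / F p * x = - (y * x) / F z / F p by ring.
  by rewrite xy; field; rewrite Fp Fz.
apply/cdiffP; exists (fun z => - (phi z * (F z)^-1) * (F p)^-1) => [|z].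
  apply: ccontM; last exact: ccont_cst.
  by apply: ccontN; apply: ccontM => //; apply: ccontV.
by rewrite subrr mulr0 addr0.
Qed.

Lemma cdiffX F k p : cdiff F p -> cdiff (fun z => F z ^+ k) p.
Proof.
move=> Fd; elim: k => [|k IH].
  by rewrite (_ : (fun z => _) = fun=> 1); [apply: cdiff_cst | apply: funext].
rewrite (_ : (fun z => _) = fun z => F z * F z ^+ k); first exact: cdiffM.
by apply: funext => z; rewrite exprS.
Qed.

End CDiff.

(** * A weak mean value inequality *)

Section MaximumModulus.
Variable R : realType.
Local Notation C := R[i].
Implicit Types (F G : C -> C) (a p z : C) (s h e : R) (n N : nat).

(** On each of the four edges the imaginary part of [dz / (z - c)] is positive. *)
Lemma contour_pole c r n (a := c - (r +i* r)) : 0 < r ->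
  12 / 5 <= nm (contour (fun z => (z - c)^-1) a (3 * r) n).
Proof.
move=> r0; apply: le_trans (le_trans (ler_norm _) (Im_le_nm _)).
rewrite /contour; set h := 3 * r / 2 ^+ n.
have hN : h * (2 ^ n)%:R = 3 * r.
  by rewrite natrX mulfVK // expf_neq0 // pnatr_eq0.
have h0 : 0 < h by rewrite divr_gt0 ?exprn_gt0 //; lra.
have -> (x : R) (w : C) : Im (x%:C * w) = x * Im w.
  by case: w => w1 w2 /=; rewrite mul0r addr0.
have ImD (w1 w2 : C) : Im (w1 + w2) = Im w1 + Im w2 by case: w1 w2 => [? ?] [].
rewrite /csum (big_morph (@complex.Im R) ImD (erefl _)).
have low (x y t : R) : 0 < t -> t <= y -> `|x| <= 2 * r -> y <= 2 * r -> r <= t ->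
    (5 * r)^-1 <= y / (x ^+ 2 + y ^+ 2).
  move=> t0 ty; rewrite ler_norml => /andP[x1 x2] y2 rt.
  have d0 : 0 < x ^+ 2 + y ^+ 2 by nra.
  have r5 : 0 < 5 * r by lra.
  by rewrite -[leLHS]mul1r ler_pdivrMr // mulrAC ler_pdivlMr //; nra.
have term (j : 'I_(2 ^ n)) : 4 / (5 * r) <=
  Im ((pt a h j 0 - c)^-1 - (pt a h j (2 ^ n) - c)^-1
      + (0 +i* 1) * ((pt a h (2 ^ n) j - c)^-1 - (pt a h 0 j - c)^-1)).
  have hj : 0 <= h * j%:R <= 3 * r.
    by rewrite mulr_ge0 ?(ltW h0) //= -hN ler_wpM2l ?(ltW h0) // ler_nat ltnW.
  pose u := h * j%:R - r.
  have -> : pt a h j 0 - c = u +i* (- r).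
    by rewrite /pt mulr0n mulr0 /a /u; case: (c) => c1 c2; simpc; congr (_ +i* _); ring.
  have -> : pt a h j (2 ^ n) - c = u +i* (2 * r).
    by rewrite /pt hN /a /u; case: (c) => c1 c2; simpc; congr (_ +i* _); ring.
  have -> : pt a h (2 ^ n) j - c = (2 * r) +i* u.
    by rewrite /pt hN /a /u; case: (c) => c1 c2; simpc; congr (_ +i* _); ring.
  have -> : pt a h 0 j - c = (- r) +i* u.
    by rewrite /pt mulr0n mulr0 /a /u; case: (c) => c1 c2; simpc; congr (_ +i* _); ring.
  rewrite /= mul0r mul1r add0r.
  have ub : `|u| <= 2 * r by rewrite ler_norml /u; move: hj; lra.
  have l1 := low u r r r0 (lexx r) ub _ (lexx r).
  have l2 := low u (2 * r) r r0 _ ub (lexx _) (lexx r).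
  have {}l1 := l1 ltac:(lra). have {}l2 := l2 ltac:(lra).
  have e1 : (- r) ^+ 2 = r ^+ 2 by rewrite sqrrN.
  move: l1 l2; rewrite ?mulNr ?opprK ?e1 ?(addrC _ (u ^+ 2)); lra.
have sum : \sum_(j < 2 ^ n) (4 / (5 * r)) <= \sum_(j < 2 ^ n)
  Im ((pt a h j 0 - c)^-1 - (pt a h j (2 ^ n) - c)^-1
      + (0 +i* 1) * ((pt a h (2 ^ n) j - c)^-1 - (pt a h 0 j - c)^-1)).
  by apply: ler_sum => j _; apply: term.
apply: le_trans (ler_wpM2l (ltW h0) sum).
rewrite sumr_const card_ord -[_ *+ (2 ^ n)]mulr_natr mulrCA [h * _]mulrC -mulrA.
rewrite [_ * h]mulrC hN le_eqVlt; apply/orP; left; apply/eqP; field.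
by rewrite gt_eqF.
Qed.

(** Cauchy's formula, up to a constant: the contour sums of
    [(F z - F c) / (z - c)] tend to 0 by [goursat_puncture], and those of
    [1 / (z - c)] are bounded below. *)
Lemma mean_weak F c r K M : 0 < r ->
  (forall z, nm (z - c) <= 3 * r -> cdiff F z) ->
  (forall z, nm (z - c) <= 3 * r -> nm (F z) <= K) ->
  (forall z, r <= nm (z - c) <= 3 * r -> nm (F z) <= M) ->
  nm (F c) <= 5 * M.
Proof.
move=> r0 Fd FK FM; pose a := c - (r +i* r); pose s := 3 * r.
have s0 : 0 < s by rewrite /s; lra.
have [c1 c2] : Re c = Re a + r /\ Im c = Im a + r.
  by rewrite /a; case: (c) => x y /=; split; ring.
have zcE z : Re (z - c) = Re z - Re c /\ Im (z - c) = Im z - Im c.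
  by case: (z) (c) => [? ?] [? ?].
have inb z : in_square a s z -> nm (z - c) <= 3 * r.
  move=> /in_squareP[/andP[z1 z2] /andP[z3 z4]].
  have [e1 e2] := zcE z; have := nm_sqr (z - c); rewrite e1 e2 => eq2.
  have := nm_ge0 (z - c); rewrite /s in z2 z4; nra.
have edge z : on_edge a s z -> r <= nm (z - c).
  move=> /andP[zin ze]; have [e1 e2] := zcE z.
  have [e3 e4] : Re (z - a) = Re z - Re a /\ Im (z - a) = Im z - Im a.
    by case: (z) (a) => [? ?] [? ?].
  have := Re_le_nm (z - c); have := Im_le_nm (z - c).
  rewrite e1 e2 !ler_norml => /andP[i1 i2] /andP[j1 j2].
  move: ze; rewrite e3 e4 => /or4P[]/eqP h; rewrite /s in h; lra.
have edge_neq z : on_edge a s z -> z - c != 0.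
  by move=> /edge; rewrite -nm_gt0; apply: lt_le_trans.
pose G z := (F z - F c) * (z - c)^-1.
have [K' GK] : exists K', forall z, in_square a s z -> nm (G z) <= K'.
  have [|d dP] := Fd c; first by rewrite subrr nm0; lra.
  have [del del0 Hd] := dP 1 ltr01.
  exists (nm d + 1 + 2 * K / del) => z /inb zc.
  have K0 : 0 <= K by apply: le_trans (FK _ zc); apply: nm_ge0.
  have q0 : 0 <= 2 * K / del by rewrite divr_ge0 //; lra.
  rewrite /G nmM nmV; have [->|zc0] := eqVneq (z - c) 0.
    by rewrite nm0 invr0 mulr0; have := nm_ge0 d; lra.
  have zc_gt : 0 < nm (z - c) by rewrite nm_gt0.
  rewrite ler_pdivrMr //; have [lt|ge] := ltP (nm (z - c)) del.
    have := Hd _ lt; rewrite subrKC => h.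
    have := nmD (F z - F c - d * (z - c)) (d * (z - c)).
    rewrite subrK nmM => h'; have := mulr_ge0 q0 (ltW zc_gt); lra.
  have h : 2 * K <= 2 * K / del * nm (z - c) by rewrite -mulrA ler_peMr ?ler_pdivlMl ?mulr1 //; lra.
  have := nmB (F z) (F c); have := FK _ zc; have := FK c; rewrite subrr nm0 => h1 h2 h3.
  have := mulr_ge0 (nm_ge0 d) (ltW zc_gt); have := h1 _; lra.
(* The boundary of the square with corner [a] and side [3 r] lies at distance
   between [r] and [3 r] from [c]. *)
have ct : at_third a s c.
  left; rewrite /a /s; case: (c) => x y.
  by apply/eqP; rewrite eq_complex /=; apply/andP; split; apply/eqP; field.
have Gd z : in_square a s z -> z != c -> cdiff G z.
  move=> /inb /Fd Fz zc; apply: cdiffM.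
    by apply: cdiffB => //; apply: cdiff_cst.
  apply: (cdiffV (F := fun z => z - c)); last by rewrite subr_eq0.
  by apply: cdiffB; [apply: cdiff_id | apply: cdiff_cst].
suff le e : 0 < e -> nm (F c) * (12 / 5) <= 12 * M + e.
  apply/ler_addgt0Pr => e e0; have := le (12 / 5 * e) _; lra.
move=> e0; have [n0 Hn] := goursat_puncture s0 e0 ct Gd GK.
have := Hn n0 (leqnn _); set T1 := contour _ a s n0.
pose T2 := contour (fun z => F z * (z - c)^-1) a s n0.
have -> : T1 = T2 + (- F c) * contour (fun z => (z - c)^-1) a s n0.
  rewrite -contourZ -contourD; apply: eq_contour; first exact: ltW.
  by move=> z _; rewrite /G mulrBl mulNr.
have := contour_pole c n0 r0; rewrite -/a -/s; set T3 := contour _ a s n0.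
have : nm T2 <= 4 * (M / r) * s.
  apply: contour_bound; first exact: ltW.
  move=> z zin; rewrite nmM nmV ler_pdivrMr ?nm_gt0 ?edge_neq //.
  have zr := edge z zin; have zb : nm (z - c) <= 3 * r by apply: inb; case/andP: zin.
  have FzM := FM z; rewrite zr zb in FzM; apply: (le_trans (FzM isT)).
  have M0 : 0 <= M by apply: le_trans (FzM isT); apply: nm_ge0.
  by rewrite -mulrA ler_peMr // ler_pdivlMl // mulr1.
have -> : 4 * (M / r) * s = 12 * M by rewrite /s; field; rewrite gt_eqF.
move=> h2 h3 h1.
have : nm (F c * T3) <= nm T2 + nm (T2 + - F c * T3).
  by have := nmB T2 (T2 + - F c * T3); rewrite opprD addNKr mulNr opprK.
rewrite nmM => h4.
have := ler_wpM2l (nm_ge0 (F c)) h3; lra.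
Qed.

End MaximumModulus.

(** * Divided differences and removable singularities *)

Section RemovableSingularities.
Variable R : realType.
Local Notation C := R[i].
Implicit Types (F G p psi : C -> C) (a c y z : C) (r s e K M : R) (E : seq C).

Lemma bernoulli_ge (q : R) k : 0 <= q -> 1 + k%:R * q <= (1 + q) ^+ k.
Proof.
move=> q0; elim: k => [|k IH]; first by rewrite mul0r addr0 expr0.
have h : (1 + q) * (1 + k%:R * q) <= (1 + q) ^+ k.+1.
  by rewrite exprS ler_wpM2l //; lra.
apply: le_trans h; rewrite -natr1.
have : 0 <= k%:R * q * q by rewrite !mulr_ge0.
lra.
Qed.

(** By Bernoulli's inequality the powers of a ratio [x / M > 1] are unbounded;
    hence an inequality between all powers, up to constants, is an inequality. *)
Lemma power_trick (x M A B : R) : 0 <= x -> 0 <= M -> 0 < A ->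
  (forall k, x ^+ k * A <= B * M ^+ k) -> x <= M.
Proof.
move=> x0 M0 A0 H; rewrite leNgt; apply/negP => Mx.
have xpos : 0 < x by lra.
have [M00|Mn0] := eqVneq M 0.
  have := H 1%N; rewrite M00 !expr1 mulr0.
  by rewrite pmulr_rle0 // leNgt A0.
have Mpos : 0 < M by rewrite lt0r Mn0.
pose q := x / M - 1.
have q0 : 0 < q by rewrite subr_gt0 ltr_pdivlMr // mul1r.
have qE : x = (1 + q) * M by rewrite /q subrKC mulfVK.
have Hk k : k%:R * (q * A) <= B.
  have Mk : 0 < M ^+ k by rewrite exprn_gt0.
  have := H k; rewrite qE exprMn mulrAC ler_pM2r // => h.
  have := ler_wpM2r (ltW A0) (bernoulli_ge k (ltW q0)); lra.
have qA : 0 < q * A by rewrite mulr_gt0.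
have B0 : 0 <= B by have := Hk 0%N; rewrite mul0r.
have := Hk (Num.bound (B / (q * A))); rewrite -ler_pdivlMr // leNgt.
by rewrite archi_boundP // divr_ge0 // ltW.
Qed.

Lemma cdiff_prod_sub E z : cdiff (fun w : C => \prod_(e <- E) (w - e)) z.
Proof.
elim: E => [|e E IH].
  rewrite (_ : (fun w => _) = fun=> 1); first exact: cdiff_cst.
  by apply: funext => w; rewrite big_nil.
rewrite (_ : (fun w => _) = fun w => (w - e) * \prod_(e <- E) (w - e)).
  by apply: cdiffM => //; apply: cdiffB; [apply: cdiff_id | apply: cdiff_cst].
by apply: funext => w; rewrite big_cons.
Qed.

Lemma cdiff_local_lipschitz F z : cdiff F z ->
  exists2 L, 0 <= L & exists2 del, 0 < del &
    forall t, nm t < del -> nm (F (z + t) - F z) <= L * nm t.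
Proof.
move=> [d Fd]; have [del del0 H] := Fd 1 ltr01.
exists (nm d + 1); first by rewrite addr_ge0 ?nm_ge0.
exists del => // t /H h.
have := nmD (F (z + t) - F z - d * t) (d * t); rewrite subrK nmM; lra.
Qed.

(** The powers of [F], multiplied by a polynomial that vanishes doubly on [E],
    are differentiable everywhere, so that [mean_weak] applies to them; letting
    the exponent grow removes the constants. *)
Lemma mean_ineq F c r K M E : 0 < r -> 0 <= M -> c \notin E ->
  (forall z, nm (z - c) <= 3 * r -> z \notin E -> cdiff F z) ->
  (forall z, nm (z - c) < 4 * r -> z \notin E -> nm (F z) <= K) ->
  (forall z, r <= nm (z - c) <= 3 * r -> z \notin E -> nm (F z) <= M) ->
  nm (F c) <= M.
Proof.
move=> r0 M0 cE Fd FK FM.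
pose V z := \prod_(e <- E) (z - e).
have V0 z : z \in E -> V z = 0.
  by move=> zE; rewrite /V (big_rem z) //= subrr mul0r.
have Vc : 0 < nm (V c).
  rewrite nm_gt0 /V prodf_seq_neq0; apply/allP => e eE /=.
  by rewrite subr_eq0; apply: contraNneq cE => ->.
pose B := \prod_(e <- E) (4 * r + nm (c - e)).
have B0 : 0 <= B by apply: prodr_ge0 => e _; have := nm_ge0 (c - e); lra.
have VB z : nm (z - c) < 4 * r -> nm (V z) <= B.
  move=> zc; rewrite /V nm_prod; apply: ler_prod => e _; rewrite nm_ge0 /=.
  by have := nm_tri c z e; lra.
have K0 : 0 <= K.
  by apply: le_trans (nm_ge0 (F c)) (FK c _ cE); rewrite subrr nm0; lra.
pose G k z := F z ^+ k * V z ^+ 2.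
have Gd k z : nm (z - c) <= 3 * r -> cdiff (G k) z.
  move=> zc; have Vd := cdiff_prod_sub E z.
  have [zE|zE] := boolP (z \in E); last first.
    by apply: cdiffM; apply: cdiffX => //; apply: Fd.
  have [L L0 [del del0 H]] := cdiff_local_lipschitz Vd.
  exists 0 => e e0.
  pose D := K ^+ k * L ^+ 2 + 1.
  have KL : 0 <= K ^+ k * L ^+ 2 by rewrite mulr_ge0 // exprn_ge0.
  have D0 : 0 < D by rewrite /D; lra.
  exists (Num.min (Num.min del r) (e / D)).
    by rewrite !lt_min del0 r0 divr_gt0.
  move=> t; rewrite !lt_min => /andP[/andP[/H tdel tr]].
  rewrite ltr_pdivlMr // => te.
  move: tdel; rewrite -!/(V _) (V0 _ zE) subr0 => tdel.
  rewrite mul0r subr0 /G (V0 _ zE) expr0n mulr0 subr0.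
  have t0 := nm_ge0 t.
  have [ztE|ztE] := boolP (z + t \in E).
    by rewrite (V0 _ ztE) expr0n mulr0 nm0 mulr_ge0 // ltW.
  have ztc : nm (z + t - c) < 4 * r.
    by have := nmD (z - c) t; rewrite addrAC; lra.
  rewrite nmM !nmX; apply: le_trans (ler_pM _ _ (lerXn2r k _ _ (FK _ ztc ztE))
    (lerXn2r 2 _ _ tdel)) _; rewrite ?nnegrE ?exprn_ge0 ?nm_ge0 ?mulr_ge0 //.
  rewrite exprMn mulrA expr2 mulrA ler_wpM2r //.
  by apply: le_trans (ltW te); rewrite mulrC ler_wpM2l // /D; lra.
apply: (power_trick (A := nm (V c) ^+ 2) (B := 5 * B ^+ 2)) => [|//||k].
- exact: nm_ge0.
- exact: exprn_gt0.
have -> : nm (F c) ^+ k * nm (V c) ^+ 2 = nm (G k c) by rewrite /G nmM !nmX.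
have -> : 5 * B ^+ 2 * M ^+ k = 5 * (M ^+ k * B ^+ 2) by ring.
have bound z L : nm (z - c) < 4 * r -> 0 <= L -> (z \notin E -> nm (F z) <= L) ->
    nm (G k z) <= L ^+ k * B ^+ 2.
  move=> zc L0 FL; rewrite /G; have [zE|zE] := boolP (z \in E).
    by rewrite (V0 _ zE) expr0n mulr0 nm0 mulr_ge0 // exprn_ge0.
  by rewrite nmM !nmX ler_pM ?exprn_ge0 ?nm_ge0 //;
    rewrite lerXn2r ?nnegrE ?nm_ge0 ?FL ?VB.
apply: (mean_weak r0 (K := K ^+ k * B ^+ 2)) => [z zc|z zc|z /andP[zr zc]].
- exact: Gd.
- by apply: bound => //; [lra | apply: FK; lra].
- by apply: bound => //; [lra | apply: FM; rewrite zr].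
Qed.

Definition hol c r M E F :=
  forall z, nm (z - c) < r -> z \notin E -> cdiff F z /\ nm (F z) <= M.

Definition divided_diff F a z := (F z - F a) / (z - a).

(** Cauchy's estimate, for divided differences instead of derivatives: away from
    [a] the bound is clear, and [mean_ineq] carries it over to points near [a]. *)
Lemma hol_divided_diff c r M E F a : 0 < r -> 0 <= M -> hol c r M E F ->
  nm (a - c) < r / 4 -> a \notin E ->
  hol c r (24 * M / r) (a :: E) (divided_diff F a).
Proof.
move=> r0 M0 FH ac aE.
have Fa : nm (F a) <= M by apply: (FH a _ aE).2; lra.
have Dd z : nm (z - c) < r -> z \notin a :: E -> cdiff (divided_diff F a) z.
  rewrite inE negb_or => zc /andP[za zE]; apply: cdiffM.
    by apply: cdiffB; [apply: (FH z zc zE).1 | apply: cdiff_cst].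
  apply: (cdiffV (F := fun w => w - a)); last by rewrite subr_eq0.
  by apply: cdiffB; [apply: cdiff_id | apply: cdiff_cst].
have far z del : 0 < del -> nm (z - c) < r -> z \notin a :: E ->
    del <= nm (z - a) -> nm (divided_diff F a z) <= 2 * M / del.
  rewrite inE negb_or => del0 zc /andP[za zE] dz.
  have Fz := (FH z zc zE).2.
  rewrite /divided_diff nmM nmV ler_pdivrMr ?nm_gt0 ?subr_eq0 //.
  apply: (le_trans (nmB _ _)); apply: (@le_trans _ _ (2 * M)); first lra.
  rewrite [leRHS](_ : _ = 2 * M * (nm (z - a) / del)); last by ring.
  by rewrite ler_peMr ?ler_pdivlMr ?mul1r //; lra.
have far12 z : nm (z - c) < r -> z \notin a :: E -> r / 12 <= nm (z - a) ->
    nm (divided_diff F a z) <= 24 * M / r.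
  move=> zc zE za; have r12 : 0 < r / 12 by lra.
  have := far z _ r12 zc zE za; rewrite (_ : 2 * M / (r / 12) = 24 * M / r) //.
  by field; rewrite gt_eqF.
have [L L0 [del del0 H]] := cdiff_local_lipschitz (FH a ltac:(lra) aE).1.
have Dbd z : nm (z - c) < r -> z \notin a :: E ->
    nm (divided_diff F a z) <= L + 2 * M / del.
  move=> zc zaE; have q0 : 0 <= 2 * M / del by rewrite divr_ge0 //; lra.
  have [lt|ge] := ltP (nm (z - a)) del; last by have := far _ _ del0 zc zaE ge; lra.
  move: zaE; rewrite inE negb_or => /andP[za zE].
  apply: (@le_trans _ _ L); last lra.
  rewrite /divided_diff nmM nmV ler_pdivrMr ?nm_gt0 ?subr_eq0 //.
  by have := H _ lt; rewrite subrKC.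
move=> z zc zaE; split; first exact: Dd.
have [near|] := ltP (nm (z - a)) (r / 12); last exact: far12.
(* The annulus of radii [r / 6] and [r / 2] around [z] stays at distance
   [r / 12] from [a] and inside the disc of radius [r]. *)
have zc' : nm (z - c) < r / 3 by have := nm_tri a z c; lra.
have r6 : 0 < r / 6 by lra.
apply: (mean_ineq (K := L + 2 * M / del) r6 _ zaE).
- by rewrite divr_ge0 //; lra.
- by move=> w wz wE; apply: Dd => //; have := nm_tri z w c; lra.
- by move=> w wz wE; apply: Dbd => //; have := nm_tri z w c; lra.
- move=> w /andP[w1 w2] wE; apply: far12 => //; first by have := nm_tri z w c; lra.
  by have := nm_tri a w z; rewrite (nm_distC a z); lra.
Qed.

(** McShane's extension formula: [l] is the supremum of
    [q y - L * |y - y0|] over [S]. *)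
Lemma lipschitz_limit (S : set C) (q : C -> R) (L : R) y0 : S !=set0 ->
  (forall y y', S y -> S y' -> q y - q y' <= L * nm (y - y')) -> 0 <= L ->
  exists l, forall y, S y -> `|q y - l| <= L * nm (y - y0).
Proof.
move=> [y1 Sy1] qL L0; pose A := [set q y - L * nm (y - y0) | y in S].
have ubA y : S y -> ubound A (q y + L * nm (y - y0)).
  move=> Sy _ [y' Sy' <-]; have := qL _ _ Sy' Sy.
  have := ler_wpM2l L0 (nm_tri y0 y' y); rewrite (nm_distC y0 y) mulrDr; lra.
have hs : has_sup A.
  by split; [exists (q y1 - L * nm (y1 - y0)), y1 | exists (q y1 + L * nm (y1 - y0)); apply: ubA].
exists (sup A) => y Sy.
have h1 : sup A <= q y + L * nm (y - y0) by apply: ge_sup; [case: hs | apply: ubA].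
have h2 : q y - L * nm (y - y0) <= sup A by apply: ub_le_sup; [case: hs | exists y].
by rewrite ler_norml; apply/andP; split; lra.
Qed.

Lemma cdiff_of_lipschitz_quotient p y0 del L : 0 < del -> 0 <= L ->
  (forall y y', 0 < nm (y - y0) < del -> 0 < nm (y' - y0) < del ->
     nm (divided_diff p y0 y - divided_diff p y0 y') <= L * nm (y - y')) ->
  cdiff p y0.
Proof.
move=> del0 L0 H; pose S := [set y | 0 < nm (y - y0) < del].
have S0 : S !=set0.
  exists (y0 + (del / 2)%:C); rewrite /S /= [y0 + _]addrC addrK nm_real.
  by rewrite ger0_norm; [apply/andP; split|]; lra.
have ReB (u v : C) : Re u - Re v = Re (u - v) by case: u v => [? ?] [].
have ImB (u v : C) : Im u - Im v = Im (u - v) by case: u v => [? ?] [].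
have [|l1 l1P] := lipschitz_limit (q := fun y => Re (divided_diff p y0 y)) (L := L) y0 S0 _ L0.
  move=> y y' Sy Sy'; rewrite ReB; apply: le_trans (H y y' Sy Sy').
  exact: le_trans (ler_norm _) (Re_le_nm _).
have [|l2 l2P] := lipschitz_limit (q := fun y => Im (divided_diff p y0 y)) (L := L) y0 S0 _ L0.
  move=> y y' Sy Sy'; rewrite ImB; apply: le_trans (H y y' Sy Sy').
  exact: le_trans (ler_norm _) (Im_le_nm _).
exists (l1 +i* l2) => e e0; have L1 : 0 < 2 * L + 1 by lra.
exists (Num.min del (e / (2 * L + 1))); first by rewrite lt_min del0 divr_gt0.
move=> t; rewrite lt_min ltr_pdivlMr // => /andP[td te].
have [->|tn0] := eqVneq t 0.
  by rewrite addr0 subrr mulr0 subr0 nm0 mulr0.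
have t0 : 0 < nm t by rewrite nm_gt0.
have St : S (y0 + t) by rewrite /S /= [y0 + t]addrC addrK t0 td.
have -> : p (y0 + t) - p y0 - (l1 +i* l2) * t =
    (divided_diff p y0 (y0 + t) - (l1 +i* l2)) * t.
  rewrite mulrBl /divided_diff; congr (_ - _).
  by rewrite [y0 + t - y0]addrAC subrr add0r mulfVK.
rewrite nmM ler_wpM2r ?(ltW t0) //.
apply: (le_trans (nm_le_Re_Im _)); rewrite -ReB -ImB.
have := l1P _ St; have := l2P _ St; rewrite [y0 + t - y0]addrAC subrr add0r /=.
have := ltW t0; lra.
Qed.

(** Pointwise limits of functions that are bounded by [M] and differentiable off
    a finite set: [psi] may depend on the finite set [ys], because a divided difference
    involves finitely many points. *)
Definition hol_limit c r M p := forall ys : seq C,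
  (forall y, y \in ys -> nm (y - c) < r) -> forall e, 0 < e ->
  exists psi E, hol c r M E psi /\
    forall y, y \in ys -> y \notin E /\ nm (psi y - p y) <= e.

Lemma hol_limit_bound c r M p y : hol_limit c r M p -> nm (y - c) < r ->
  nm (p y) <= M.
Proof.
move=> pl yc; apply/ler_addgt0Pr => e e0.
have [|psi [E [H Hy]]] := pl [:: y] _ e e0.
  by move=> z; rewrite inE => /eqP ->.
have [yE ye] := Hy y (mem_head _ _); have := (H y yc yE).2.
by have := nmB (psi y) (psi y - p y); rewrite subKr; lra.
Qed.

(** Second divided differences of the approximating functions are uniformly
    bounded by [hol_divided_diff], hence the difference quotient of [p] at [y0]
    is Lipschitz. *)
Lemma hol_limit_cdiff c r M p y0 : 0 < r -> 0 <= M -> hol_limit c r M p ->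
  nm (y0 - c) < r / 4 -> cdiff p y0.
Proof.
move=> r0 M0 pl y0c; set L := 24 * (24 * M / r) / r.
have L1 : 0 <= 24 * M / r by rewrite divr_ge0 //; lra.
have L0 : 0 <= L by rewrite /L divr_ge0 //; lra.
have del0 : 0 < r / 4 - nm (y0 - c) by lra.
apply: (cdiff_of_lipschitz_quotient del0 L0) => y y' /andP[yp yd] /andP[yp' yd'].
have [->|yy'] := eqVneq y y'; first by rewrite !subrr nm0 mulr0.
have yc : nm (y - c) < r / 4 by have := nm_tri y0 y c; lra.
have yc' : nm (y' - c) < r / 4 by have := nm_tri y0 y' c; lra.
apply/ler_addgt0Pr => e e0.
pose m := Num.min (nm (y - y0)) (nm (y' - y0)).
have m0 : 0 < m by rewrite lt_min yp.
have e1 : 0 < e * m / 4 by rewrite divr_gt0 // mulr_gt0.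
have [|psi [E [H HE]]] := pl [:: y0; y; y'] _ _ e1.
  by move=> z; rewrite !inE => /or3P[] /eqP ->; lra.
have [] := HE y0; first by rewrite !inE eqxx.
have [] := HE y; first by rewrite !inE eqxx orbT.
have [] := HE y'; first by rewrite !inE eqxx !orbT.
move=> yE' ye' yE ye yE0 ye0.
have yn : y != y0 by rewrite -subr_eq0 -nm_gt0.
have yn' : y' != y0 by rewrite -subr_eq0 -nm_gt0.
have H1 := hol_divided_diff r0 M0 H y0c yE0.
have yE1 : y' \notin y0 :: E by rewrite inE negb_or yn'.
have H2 := hol_divided_diff r0 L1 H1 yc' yE1.
have yE2 : y \notin y' :: y0 :: E by rewrite !inE !negb_or yy' yn.
have := (H2 y ltac:(lra) yE2).2; rewrite {1}/divided_diff nmM nmV -/L.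
rewrite ler_pdivrMr ?nm_gt0 ?subr_eq0 // => h.
have close w : 0 < nm (w - y0) -> m <= nm (w - y0) -> nm (psi w - p w) <= e * m / 4 ->
    nm (divided_diff psi y0 w - divided_diff p y0 w) <= e / 2.
  move=> w0 wm we; rewrite /divided_diff -mulrBl nmM nmV ler_pdivrMr //.
  have -> : psi w - psi y0 - (p w - p y0) = (psi w - p w) - (psi y0 - p y0) by ring.
  apply: (le_trans (nmB _ _)).
  have := ler_wpM2l (ltW e0) wm; lra.
have c1 := close y yp _ ye; have c2 := close y' yp' _ ye'.
have {}c1 : nm (divided_diff psi y0 y - divided_diff p y0 y) <= e / 2.
  by apply: c1; rewrite /m ge_min lexx.
have {}c2 : nm (divided_diff psi y0 y' - divided_diff p y0 y') <= e / 2.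
  by apply: c2; rewrite /m ge_min lexx orbT.
have t1 := nm_tri (divided_diff psi y0 y) (divided_diff p y0 y) (divided_diff p y0 y').
have t2 := nm_tri (divided_diff psi y0 y') (divided_diff psi y0 y) (divided_diff p y0 y').
by rewrite (nm_distC (divided_diff p y0 y) (divided_diff psi y0 y)) in t1; lra.
Qed.

End RemovableSingularities.

(** * Polynomial functions *)

Section PolynomialFunctions.
Variables (C : numClosedFieldType) (n : nat).
Local Notation mpol := (mpoly.mpoly n C).
Implicit Types (p q : mpol) (z : 'cV[C]_n).

Definition mvar (i : 'I_n) : mpol := mpoly.mpolyX C (mpoly.mnm1 i).
Definition mcst (c : C) : mpol := mpoly.mpolyC n c.

Lemma poly_fun_mvar i z : poly_fun (mvar i) z = z i 0.
Proof. exact: mpoly.mevalXU. Qed.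

Lemma poly_fun_mcst c z : poly_fun (mcst c) z = c.
Proof. exact: mpoly.mevalC. Qed.

Lemma poly_fun0 z : poly_fun (0 : mpol) z = 0.
Proof. exact: mpoly.meval0. Qed.

Lemma poly_fun1 z : poly_fun (1 : mpol) z = 1.
Proof. exact: mpoly.meval1. Qed.

Lemma poly_funD p q z : poly_fun (p + q) z = poly_fun p z + poly_fun q z.
Proof. exact: mpoly.mevalD. Qed.

Lemma poly_funB p q z : poly_fun (p - q) z = poly_fun p z - poly_fun q z.
Proof. exact: mpoly.mevalB. Qed.

Lemma poly_funM p q z : poly_fun (p * q) z = poly_fun p z * poly_fun q z.
Proof. exact: mpoly.mevalM. Qed.

Lemma poly_funX p k z : poly_fun (p ^+ k) z = poly_fun p z ^+ k.
Proof. by elim: k => [|k IH]; rewrite ?expr0 ?poly_fun1 // !exprS poly_funM IH. Qed.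

Lemma poly_fun_sum (I : Type) (s : seq I) (P : pred I) (F : I -> mpol) z :
  poly_fun (\sum_(i <- s | P i) F i) z = \sum_(i <- s | P i) poly_fun (F i) z.
Proof.
by elim/big_rec2: _ => [|i y x _ <-]; rewrite ?poly_fun0 // poly_funD.
Qed.

Lemma poly_fun_prod (I : Type) (s : seq I) (P : pred I) (F : I -> mpol) z :
  poly_fun (\prod_(i <- s | P i) F i) z = \prod_(i <- s | P i) poly_fun (F i) z.
Proof.
by elim/big_rec2: _ => [|i y x _ <-]; rewrite ?poly_fun1 // poly_funM.
Qed.

Lemma poly_fun_comp (t : n.-tuple mpol) q z :
  poly_fun (mpoly.comp_mpoly t q) z = poly_fun q (poly_map t z).
Proof.
rewrite /poly_fun mpoly.comp_mpoly_meval; apply: mpoly.meval_eq => i.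
by rewrite mxE.
Qed.

Lemma mpoly_ring_ind (P : mpol -> Prop) :
  (forall c, P (mcst c)) -> (forall i, P (mvar i)) ->
  (forall p q, P p -> P q -> P (p + q)) ->
  (forall p q, P p -> P q -> P (p * q)) -> forall p, P p.
Proof.
move=> Pc Pv PD PM; have P1 : P 1 by rewrite -(mpoly.mpolyC1 n C).
elim/mpoly.mpolyind => [|c m p _ _ Pp].
  by rewrite -(mpoly.mpolyC0 n C).
apply: PD => //; rewrite -mpoly.mul_mpolyC; apply: (PM) => //.
rewrite mpoly.mpolyXE_id; elim/big_ind: _ => // i _.
by elim: (m i) => [|k IH]; rewrite ?expr0 // exprS; apply: (PM) => //; apply: (Pv).
Qed.

Lemma poly_fun_ind (P : ('cV[C]_n -> C) -> Prop) :
  (forall c, P (fun=> c)) -> (forall i, P (fun z => z i 0)) ->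
  (forall f g, P f -> P g -> P (fun z => f z + g z)) ->
  (forall f g, P f -> P g -> P (fun z => f z * g z)) ->
  forall p, P (poly_fun p).
Proof.
move=> Pc Pv PD PM; elim/mpoly_ring_ind => [c|i|p q Pp Pq|p q Pp Pq].
- by rewrite (funext (poly_fun_mcst c)).
- by rewrite (funext (poly_fun_mvar i)).
- by rewrite (funext (poly_funD p q)); apply: PD.
- by rewrite (funext (poly_funM p q)); apply: PM.
Qed.

Lemma digits_inj D m (a b : nat -> nat) :
  (forall i, (i < m)%N -> (a i < D)%N) -> (forall i, (i < m)%N -> (b i < D)%N) ->
  (\sum_(i < m) a i * D ^ i = \sum_(i < m) b i * D ^ i)%N ->
  forall i, (i < m)%N -> a i = b i.
Proof.
elim: m a b => [//|m IH] a b aD bD.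
have shift (c : nat -> nat) : (\sum_(i < m.+1) c i * D ^ i =
    c 0%N + (\sum_(i < m) c i.+1 * D ^ i) * D)%N.
  rewrite big_ord_recl /= expn0 muln1 big_distrl /=; congr addn.
  by apply: eq_bigr => i _; rewrite /bump /= add1n expnS -mulnA (mulnC D).
have D0 : (0 < D)%N by apply: leq_ltn_trans (aD 0%N _).
rewrite !shift => E.
have E0 : a 0%N = b 0%N.
  have := congr1 (modn^~ D) E.
  by rewrite /= !(addnC _ (_ * D)%N) !modnMDl !modn_small ?aD ?bD.
have E1 := E; rewrite E0 in E1; move/addnI/eqP: E1; rewrite eqn_pmul2r // => /eqP E1.
case=> [//|i]; rewrite ltnS => im.
by apply: (IH (fun i => a i.+1) (fun i => b i.+1)) => // j jm; [apply: aD | apply: bD].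
Qed.

(** Kronecker's substitution [z_i = t ^ (D ^ i)] turns distinct monomials into
    distinct powers of [t]. *)
Lemma poly_fun_inj p q : (forall z, poly_fun p z = poly_fun q z) -> p = q.
Proof.
move=> pq; apply/eqP; rewrite -subr_eq0.
have : forall z, poly_fun (p - q) z = 0 by move=> z; rewrite poly_funB pq subrr.
move: (p - q) => {pq} {}p {}p0.
pose D := mpoly.msize p.
pose phi (m : mpoly.multinom n) := (\sum_(i < n) m i * D ^ i)%N.
pose U : {poly C} := \sum_(m <- mpoly.msupp p) mpoly.mcoeff m p *: 'X^(phi m).
have U0 t : U.[t] = 0.
  rewrite -(p0 (\col_i t ^+ (D ^ i))) /poly_fun mpoly.mevalE horner_sum.
  apply: eq_bigr => m _; rewrite hornerZ hornerXn; congr (_ * _).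
  rewrite /phi expr_sum; apply: eq_bigr => i _.
  by rewrite mxE -exprM mulnC.
have UU : U = 0.
  apply/eqP; apply: contraT => Un0.
  pose rs : seq C := [seq k%:R | k <- iota 0 (size U)].
  have rs_root : all (root U) rs by apply/allP => x _; rewrite /root U0.
  have rs_uniq : uniq rs.
    rewrite map_inj_uniq ?iota_uniq // => k l /eqP.
    by rewrite eqr_nat => /eqP.
  have := max_poly_roots Un0 rs_root rs_uniq.
  by rewrite size_map size_iota ltnn.
apply/eqP/mpoly.mpolyP => m; rewrite mpoly.mcoeff0.
apply/eqP; rewrite mpoly.mcoeff_eq0; apply/negP => mp.
have := congr1 (fun V : {poly C} => V`_(phi m)) UU.
rewrite coef0 coef_sum (bigD1_seq m) ?mpoly.msupp_uniq //= coefZ coefXn eqxx mulr1.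
rewrite big1_seq ?addr0 => [/eqP|m' /andP[mm' m'p]].
  by rewrite mpoly.mcoeff_eq0 mp.
rewrite coefZ coefXn; case: eqP => [E|_]; last by rewrite mulr0.
case/eqP: mm'; apply/mpoly.mnmP => i; symmetry.
have small (u : mpoly.multinom n) : u \in mpoly.msupp p -> forall k : 'I_n, (u k < D)%N.
  move=> /mpoly.msize_mdeg_lt; rewrite mpoly.mdegE => h k.
  by apply: leq_ltn_trans h; rewrite (bigD1 k) //= leq_addr.
pose ext (u : mpoly.multinom n) (k : nat) := if insub k is Some k' then u k' else 0%N.
have extE u (k : 'I_n) : ext u k = u k by rewrite /ext valK.
rewrite -!extE; apply: (@digits_inj D n) => // [k kn|k kn|].
- by rewrite -[k]/(nat_of_ord (Ordinal kn)) extE small.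
- by rewrite -[k]/(nat_of_ord (Ordinal kn)) extE small.
- by under eq_bigr do rewrite extE; under [RHS]eq_bigr do rewrite extE.
Qed.

Definition affine_comp (A : 'M[C]_n) (b : 'cV[C]_n) p : mpol :=
  mpoly.comp_mpoly [tuple \sum_j mcst (A i j) * mvar j + mcst (b i 0) | i < n] p.

Lemma poly_fun_affine A b p z :
  poly_fun (affine_comp A b p) z = poly_fun p (A *m z + b).
Proof.
rewrite poly_fun_comp; congr poly_fun; apply/matrixP => i j; rewrite ord1.
rewrite !mxE tnth_mktuple poly_funD poly_fun_mcst poly_fun_sum; congr (_ + _).
by apply: eq_bigr => k _; rewrite poly_funM poly_fun_mcst poly_fun_mvar.
Qed.

End PolynomialFunctions.

(** * Taylor polynomials in several variables *)

Section Taylor.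
Variables (R : realType) (n : nat).
Local Notation C := R[i].
Implicit Types (f g : 'cV[C]_n -> C) (z : 'cV[C]_n) (i j : 'I_n) (r M : R).

Definition upd z i (t : C) : 'cV[C]_n := \col_k (if k == i then t else z k 0).

Definition polydisc r : set 'cV[C]_n := [set z | forall i, nm (z i 0) < r].

Definition l1norm z : R := \sum_i nm (z i 0).

Lemma updE z i t k : upd z i t k 0 = if k == i then t else z k 0.
Proof. by rewrite mxE. Qed.

Lemma col_eqP (z w : 'cV[C]_n) : (forall i, z i 0 = w i 0) -> z = w.
Proof. by move=> h; apply/matrixP => i j; rewrite ord1. Qed.

Lemma upd_id z i : upd z i (z i 0) = z.
Proof. by apply: col_eqP => k; rewrite updE; case: eqP => // ->. Qed.

Lemma upd_upd z i s t : upd (upd z i s) i t = upd z i t.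
Proof. by apply: col_eqP => k; rewrite !updE; case: eqP. Qed.

Lemma updC z i j s t : i != j -> upd (upd z i s) j t = upd (upd z j t) i s.
Proof.
move=> ij; apply: col_eqP => k; rewrite !updE.
by case: eqP => // ->; rewrite eq_sym (negbTE ij).
Qed.

Lemma polydisc_upd r z i t : polydisc r z -> nm t < r -> polydisc r (upd z i t).
Proof. by move=> zr tr k; rewrite updE; case: eqP. Qed.

Lemma polydisc_sub r s z : r <= s -> polydisc r z -> polydisc s z.
Proof. by move=> rs zr i; apply: lt_le_trans rs. Qed.

Definition sephol r M f := forall z, polydisc r z ->
  nm (f z) <= M /\ forall i, cdiff (fun t => f (upd z i t)) (z i 0).

Lemma sephol_slice r M f z i : sephol r M f -> polydisc r z ->
  hol 0 r M [::] (fun t => f (upd z i t)).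
Proof.
move=> fh zr t; rewrite subr0 => tr _.
have [fM fd] := fh _ (polydisc_upd i zr tr); split => //.
have := fd i; rewrite updE eqxx; congr (cdiff _ _).
by apply: funext => s; rewrite upd_upd.
Qed.

Lemma sephol_restrict r M f i : 0 < r -> sephol r M f ->
  sephol r M (fun z => f (upd z i 0)).
Proof.
move=> r0 fh z zr; have zi : polydisc r (upd z i 0).
  by apply: polydisc_upd => //; rewrite nm0.
have [fM fd] := fh _ zi; split => // j.
have [->|ij] := eqVneq j i.
  rewrite (_ : (fun t => _) = fun=> f (upd z i 0)); first exact: cdiff_cst.
  by apply: funext => t; rewrite upd_upd.
have := fd j; rewrite updE (negbTE ij); congr (cdiff _ _).
by apply: funext => t; rewrite updC // eq_sym.
Qed.

Definition cderiv (F : C -> C) p : C := xget 0 [set d : C | forall e, 0 < e ->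
  exists2 del, 0 < del &
    forall t, nm t < del -> nm (F (p + t) - F p - d * t) <= e * nm t].

Lemma cderivP (F : C -> C) p : cdiff F p -> forall e, 0 < e ->
  exists2 del, 0 < del &
    forall t, nm t < del -> nm (F (p + t) - F p - cderiv F p * t) <= e * nm t.
Proof. by move=> [d dP]; apply: (xgetI 0 (dP : [set d : C | _] d)). Qed.

(** The value on [z_i = 0] is the limit of the quotients, see [quot_limit]. *)
Definition quot f i z : C :=
  if z i 0 == 0 then cderiv (fun t => f (upd z i t)) 0
  else (f z - f (upd z i 0)) / z i 0.

Lemma quotE f i z : f z = f (upd z i 0) + z i 0 * quot f i z.
Proof.
rewrite /quot; have [z0|z0] := eqVneq (z i 0) 0.
  by rewrite z0 mul0r addr0 -[in RHS]z0 upd_id.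
by rewrite mulrC divfK ?subrKC.
Qed.

Lemma quot_limit r M f i z e : 0 < r -> sephol r M f -> polydisc r z -> 0 < e ->
  exists2 del, 0 < del & forall h, 0 < nm h < del ->
    h != z i 0 /\
    nm (divided_diff (fun t => f (upd z i t)) h (z i 0) - quot f i z) <= e.
Proof.
move=> r0 fh zr e0; pose F t := f (upd z i t).
have F0 : cdiff F 0.
  have h0 : nm (0 - 0 : C) < r by rewrite subr0 nm0.
  exact: (sephol_slice i fh zr h0 isT).1.
rewrite /quot; have [z0|z0] := eqVneq (z i 0) 0.
  have [del del0 H] := cderivP F0 e0; exists del => // h /andP[h0 /H].
  rewrite z0 -nm_gt0 h0 add0r /divided_diff -/(F h) -/(F 0) => hh; split => //.
  have hn : h != 0 by rewrite -nm_gt0.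
  rewrite -(ler_pM2r h0) -nmM.
  have -> : ((F 0 - F h) / (0 - h) - cderiv F 0) * h = F h - F 0 - cderiv F 0 * h.
    by rewrite sub0r; field.
  exact: hh.
have Fc : ccont (divided_diff F (z i 0)) 0.
  apply: ccontM; first by apply: ccontD; [apply: cdiff_continuous | apply: ccont_cst].
  apply: (ccontV (F := fun t => t - z i 0)); first by rewrite sub0r oppr_eq0.
  by apply: ccontD; [apply: ccont_id | apply: ccont_cst].
have [del del0 H] := Fc e e0.
exists (Num.min del (nm (z i 0))); first by rewrite lt_min del0 nm_gt0.
move=> h; rewrite lt_min => /and3P[h0 /H hh hz].
have hzi : h != z i 0 by apply: contraTneq hz => ->; rewrite ltxx.
split => //; move: hh; rewrite add0r /divided_diff /F upd_id.
by rewrite sub0r -(opprB (z i 0) h) -(opprB (f z)) -(opprB (f z) (f (upd z i 0)))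
  !invrN !mulrNN.
Qed.

(** Nodes of a divided difference can be chosen uniformly small for finitely
    many base points. *)
Lemma common_small (T : eqType) (s : seq T) (P : T -> C -> Prop) :
  (forall y, y \in s -> exists2 del : R, 0 < del &
     forall h, 0 < nm h < del -> P y h) ->
  exists2 del : R, 0 < del &
    forall h, 0 < nm h < del -> forall y, y \in s -> P y h.
Proof.
elim: s => [|x s IH] H; first by exists 1.
have [|d1 d10 H1] := IH; first by move=> y ys; apply: H; rewrite inE ys orbT.
have [d2 d20 H2] := H x (mem_head _ _).
exists (Num.min d1 d2); first by rewrite lt_min d10.
move=> h; rewrite lt_min => /and3P[h0 hd1 hd2] y; rewrite inE => /predU1P[->|ys].
  by apply: H2; rewrite h0.
by apply: H1; rewrite ?h0.
Qed.

(** In the [i]-th coordinate, [quot f i] is the limit of the divided differences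
    of [f] with node [h], as [h] tends to 0; in every coordinate these are
    differentiable, and [hol_divided_diff] bounds them. *)
Lemma quot_hol_limit r M f i j z : 0 < r -> 0 <= M -> sephol r M f ->
  polydisc r z ->
  hol_limit 0 r (24 * M / r) (fun t => quot f i (upd z j t)).
Proof.
move=> r0 M0 fh zr ys ysr e e0.
pose P y h := h != (upd z j y) i 0 /\
  nm (divided_diff (fun t => f (upd (upd z j y) i t)) h (upd z j y i 0)
      - quot f i (upd z j y)) <= e.
have [|del del0 H] := common_small (s := z j 0 :: ys) (P := P).
  move=> y; rewrite inE => yys; apply: quot_limit (fh) _ e0 => //.
  apply: polydisc_upd => //; case/predU1P: yys => [->|/ysr]; first exact: zr.
  by rewrite subr0.
have [h h0 [hdel hr]] : exists2 h : C, 0 < nm h & nm h < del /\ nm h < r / 4.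
  pose m := Num.min del (r / 4); have m0 : 0 < m by rewrite lt_min del0; lra.
  exists (m / 2)%:C; rewrite nm_real ger0_norm; try lra.
  have : m <= del by rewrite ge_min lexx.
  have : m <= r / 4 by rewrite ge_min lexx orbT.
  by split; lra.
have {}H := H h; rewrite h0 hdel in H; have {}H := H isT.
have hr0 : nm (h - 0) < r / 4 by rewrite subr0.
have [ij|ij] := eqVneq j i.
  subst j; exists (divided_diff (fun t => f (upd z i t)) h), [:: h]; split.
    by apply: hol_divided_diff => //; apply: sephol_slice.
  move=> y yys; have [] := H y; first by rewrite inE yys orbT.
  rewrite updE eqxx inE eq_sym => -> /=; split => //.
  move: b; congr (nm (divided_diff _ _ _ - _) <= _).
  by apply: funext => t; rewrite upd_upd.
pose x := z i 0.
have xE y : upd z j y i 0 = x by rewrite updE eq_sym (negbTE ij).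
exists (fun t => divided_diff (fun s => f (upd (upd z j t) i s)) h x), [::].
split; last first.
  move=> y yys; split => //; have [|_] := H y; first by rewrite inE yys orbT.
  by rewrite xE.
have xh : x != h.
  by have [] := H (z j 0) (mem_head _ _); rewrite xE eq_sym.
have xr : nm x < r by apply: zr.
have slice s y : nm s < r -> nm y < r ->
    cdiff (fun t => f (upd (upd z j t) i s)) y.
  move=> sr yr; have zs : polydisc r (upd z i s) by apply: polydisc_upd.
  have := sephol_slice j fh zs; move/(_ y); rewrite subr0 => /(_ yr isT)[+ _].
  by congr (cdiff _ _); apply: funext => t; rewrite updC // eq_sym.
move=> y; rewrite subr0 => yr _; split.
  apply: cdiffM; last exact: cdiff_cst.
  by apply: cdiffB; apply: slice => //; lra.
have zy : polydisc r (upd z j y) by apply: polydisc_upd.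
(* The bound comes from the slice in the direction [i], for fixed [y]. *)
have := hol_divided_diff r0 M0 (sephol_slice i fh zy) hr0 isT.
by move/(_ x); rewrite subr0 inE => /(_ xr xh)[].
Qed.

Lemma sephol_quot r M f i : 0 < r -> 0 <= M -> sephol r M f ->
  sephol (r / 4) (24 * M / r) (quot f i).
Proof.
move=> r0 M0 fh z zr4; have r4 : r / 4 <= r by lra.
have zr := polydisc_sub r4 zr4.
have H j := quot_hol_limit i j r0 M0 fh zr.
split=> [|j].
  have := hol_limit_bound (H i) (y := z i 0); rewrite subr0 upd_id; apply.
  exact: zr.
have M4 : 0 <= 24 * M / r by rewrite divr_ge0 //; lra.
by apply: (hol_limit_cdiff r0 M4 (H j)); rewrite subr0; apply: zr4.
Qed.

Definition depends_on (l : seq 'I_n) f :=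
  forall z w : 'cV[C]_n, (forall i, i \in l -> z i 0 = w i 0) -> f z = f w.

Definition poly_approx k f := exists p K del, [/\ 0 <= K, 0 < del &
  forall z, polydisc del z -> nm (f z - poly_fun p z) <= K * l1norm z ^+ k].

Lemma l1norm_ge0 z : 0 <= l1norm z.
Proof. by apply: sumr_ge0 => i _; apply: nm_ge0. Qed.

Lemma l1norm_coord z i : nm (z i 0) <= l1norm z.
Proof.
by rewrite /l1norm (bigD1 i) //= lerDl; apply: sumr_ge0 => j _; apply: nm_ge0.
Qed.

(** A separately differentiable bounded function has Taylor polynomials of all
    orders: dividing by one coordinate at a time,
    [f = f(z with z_i = 0) + z_i * quot f i], eliminates the coordinates. *)
Lemma sephol_poly_approx l f r M k : 0 < r -> 0 <= M -> sephol r M f ->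
  depends_on l f -> poly_approx k f.
Proof.
elim: l f r M k => [|i l IHl] f r M k r0 M0.
  move=> _ fl; exists (mcst n (f 0)), 0, 1; split=> // z _.
  by rewrite poly_fun_mcst (fl z 0) // subrr nm0 mul0r.
elim: k f r M r0 M0 => [|k IHk] f r M r0 M0 fh fl.
  exists 0, M, r; split=> // z zr; rewrite poly_fun0 subr0 expr0 mulr1.
  by have [] := fh z zr.
have [|p0 [K0 [d0 [K00 d00 H0]]]] := IHl (fun z => f (upd z i 0)) r M k.+1 r0 M0
    (sephol_restrict i r0 fh).
  move=> z w zw; apply: fl => j; rewrite inE !updE; case: eqP => //= _.
  exact: zw.
have r4 : 0 < r / 4 by lra.
have M4 : 0 <= 24 * M / r by rewrite divr_ge0 //; lra.
have [|p1 [K1 [d1 [K10 d10 H1]]]] := IHk (quot f i) _ _ r4 M4 (sephol_quot i r0 M0 fh).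
  move=> z w zw; have zwi : z i 0 = w i 0 by apply: zw; rewrite mem_head.
  have E : (fun t => f (upd z i t)) = (fun t => f (upd w i t)).
    apply: funext => t; apply: fl => j jl; rewrite !updE; case: eqP => // _.
    exact: zw.
  have E0 := congr1 (fun F => F 0) E; have Ez := congr1 (fun F => F (z i 0)) E.
  by move: Ez; rewrite /quot /= E0 E upd_id zwi upd_id => ->.
exists (p0 + mvar R[i] i * p1), (K0 + K1), (Num.min d0 d1); split.
- by rewrite addr_ge0.
- by rewrite lt_min d00.
move=> z zd.
have zd0 : polydisc d0 z by apply: polydisc_sub zd; rewrite ge_min lexx.
have zd1 : polydisc d1 z by apply: polydisc_sub zd; rewrite ge_min lexx orbT.
rewrite (quotE f i z) poly_funD poly_funM poly_fun_mvar.
rewrite opprD addrACA -mulrBr mulrDl; apply: (le_trans (nmD _ _)).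
apply: lerD; first exact: H0.
rewrite nmM exprS mulrCA; apply: ler_pM; rewrite ?nm_ge0 ?l1norm_coord //.
exact: H1.
Qed.

End Taylor.

(** * Groups of matrices, linear forms, and Lipschitz bounds *)

Section Groups.
Variables (R : realType) (n : nat).
Local Notation C := R[i].
Local Notation mpol := (mpoly.mpoly n C).
Implicit Types (p q : mpol) (z v : 'cV[C]_n) (G : set 'M[C]_n).

Definition enumerates (L : seq 'M[C]_n) G := uniq L /\ forall rho, G rho <-> rho \in L.

Lemma reflection_group_enum G : finite_pseudoreflection_group G ->
  GL_subgroup G /\ exists L, enumerates L G.
Proof.
move=> [finG [S Srefl GE]].
have unit_group : GL_subgroup [set rho : 'M[C]_n | rho \in unitmx].
  split=> /= [//||rho sigma h1 h2|rho h]; first exact: unitmx1.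
  - by rewrite unitmx_mul h1.
  - by rewrite unitmx_inv.
have S_unit : S `<=` [set rho : 'M[C]_n | rho \in unitmx].
  by move=> rho /Srefl[].
split.
  rewrite GE; split=> [rho h|A [[]] //|rho sigma h1 h2 A AP|rho h A AP].
  - exact: (h _ (conj unit_group S_unit)).
  - by have [[_ _ M _] _] := AP; apply: M; [apply: h1 | apply: h2].
  - by have [[_ _ _ V] _] := AP; apply: V; apply: h.
have /finite_seqP[s {GE}->] := finG.
exists (undup s); split; first exact: undup_uniq.
by move=> rho; rewrite mem_undup.
Qed.

Section GroupSums.
Variables (G : set 'M[C]_n) (L : seq 'M[C]_n).
Hypotheses (GG : GL_subgroup G) (GL : enumerates L G).

Lemma unit_in_enum : 1%:M \in L.
Proof. by apply/GL.2; case: GG. Qed.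

Lemma perm_translate sigma : G sigma -> perm_eq [seq rho *m sigma | rho <- L] L.
Proof.
move=> Gs; have [Lu LG] := GL; have [Gu _ GM GV] := GG.
have inj : injective (fun rho : 'M[C]_n => rho *m sigma).
  by move=> A B /(congr1 (mulmx^~ (invmx sigma))); rewrite /= !mulmxK ?Gu.
apply: uniq_perm => //; first by rewrite map_inj_uniq.
move=> rho; apply/mapP/idP => [[tau /LG Gt ->]|/LG Gr].
  by apply/LG; apply: GM.
exists (rho *m invmx sigma); last by rewrite mulmxKV ?Gu.
by apply/LG; apply: GM => //; apply: GV.
Qed.

(** Translation by [sigma] permutes the group. *)
Lemma big_translate (T : Type) (idx : T) (op : Monoid.com_law idx)
    (F : 'M[C]_n -> T) sigma : G sigma ->
  \big[op/idx]_(rho <- L) F (rho *m sigma) = \big[op/idx]_(rho <- L) F rho.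
Proof.
by move=> Gs; rewrite -[RHS](perm_big _ (perm_translate Gs)) big_map.
Qed.

Lemma invariant_big (T : Type) (idx : T) (op : Monoid.com_law idx)
    (h : 'cV[C]_n -> T) sigma z : G sigma ->
  \big[op/idx]_(rho <- L) h (rho *m (invmx sigma *m z)) =
  \big[op/idx]_(rho <- L) h (rho *m z).
Proof.
move=> Gs; have [_ _ _ GV] := GG.
rewrite -(big_translate op (fun rho => h (rho *m z)) (GV _ Gs)).
by apply: eq_bigr => rho _; rewrite mulmxA.
Qed.

End GroupSums.

Definition linform N (s : {ffun 'I_n -> 'I_N}) v : C := \sum_i (s i)%:R * v i 0.

(** The coefficients of the form are chosen one after the other: each of the
    [N] vectors excludes at most one of the [N + 1] candidates for the next
    coefficient. The point is that finitely many forms suffice for all families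
    [v]. *)
Lemma generic_linform (T : finType) : exists2 c : R, 0 <= c &
  forall v : T -> 'cV[C]_n, exists s : {ffun 'I_n -> 'I_#|T|.+1},
    forall k, l1norm (v k) <= c * nm (linform s (v k)).
Proof.
pose N := #|T|; pose B : R := 2 * N%:R + 4.
have B0 : 0 < B by rewrite /B; have := ler0n R N; lra.
suff : forall l : seq 'I_n, uniq l -> exists2 c : R, 0 <= c &
    forall v : T -> 'cV[C]_n, exists s : {ffun 'I_n -> 'I_N.+1},
      forall k i, i \in l -> nm (v k i 0) <= c * nm (\sum_(i <- l) (s i)%:R * v k i 0).
  move=> /(_ (index_enum 'I_n) (index_enum_uniq _))[c c0 H].
  exists (n%:R * c) => [|v]; first by rewrite mulr_ge0.
  have [s Hs] := H v; exists s => k; rewrite -mulrA /l1norm.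
  apply: (le_trans (ler_sum _ (fun i _ => Hs k i (mem_index_enum i)))).
  by rewrite sumr_const card_ord mulr_natl.
elim=> [_|i l IH /= /andP[il ul]].
  by exists 0 => // v; exists [ffun=> ord0].
have [c c0 H] := IH ul; exists ((1 + c) * B); first by rewrite mulr_ge0 //; lra.
move=> v; have [s Hs] := H v.
pose A k := \sum_(j <- l) (s j)%:R * v k j 0; pose x k := v k i 0.
have [a Ha] : exists a : 'I_N.+1, forall k,
    Num.max (nm (A k)) (nm (x k)) <= B * nm (a%:R * x k + A k).
  apply: contrapT => na.
  (* Otherwise two candidates [a < b] fail for the same vector [v (g a)]. *)
  have /choice[g gP] : forall a : 'I_N.+1, exists k,
      B * nm (a%:R * x k + A k) < Num.max (nm (A k)) (nm (x k)).
    move=> a; apply: contrapT => nk; apply: na; exists a => k.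
    by rewrite leNgt; apply/negP => lt; apply: nk; exists k.
  have /injectivePn[a [b ab gab]] : ~~ injectiveb g.
    apply/negP => /injectiveP/leq_card; rewrite card_ord.
    by rewrite ltnn.
  wlog lt : a b ab gab / (a < b)%N.
    move=> W; have [lt|lt|/val_inj E] := ltngtP a b; first exact: (W a b).
    - by apply: (W b a) => //; rewrite eq_sym.
    - by rewrite E eqxx in ab.
  have ha := gP a; have hb := gP b; rewrite -gab in hb; move: ha hb.
  set X := x (g a); set Y := A (g a); set m := Num.max _ _ => ha hb.
  have ba : (1 : R) <= (b - a)%:R by rewrite ler1n subn_gt0.
  have X_le : nm X <= nm (a%:R * X + Y) + nm (b%:R * X + Y).
    have E : (b - a)%:R * X = (b%:R * X + Y) - (a%:R * X + Y).
      by rewrite natrB ?(ltnW lt) //; ring.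
    have := nmB (b%:R * X + Y) (a%:R * X + Y).
    by rewrite -E nmM nm_nat; have := ler_wpM2r (nm_ge0 X) ba; rewrite mul1r; lra.
  have Y_le : nm Y <= nm (a%:R * X + Y) + N%:R * nm X.
    have E : Y = (a%:R * X + Y) - a%:R * X by ring.
    have := nmB (a%:R * X + Y) (a%:R * X); rewrite -E nmM nm_nat => h.
    apply: (le_trans h); rewrite lerD2l ler_wpM2r ?nm_ge0 // ler_nat.
    by rewrite -ltnS.
  have N0 := ler0n R N.
  have e1 := nm_ge0 (a%:R * X + Y); have e2 := nm_ge0 (b%:R * X + Y).
  have : m <= nm (a%:R * X + Y) + (N%:R + 1) * (nm (a%:R * X + Y) + nm (b%:R * X + Y)).
    rewrite /m ge_max; apply/andP; split.
      have := ler_wpM2l N0 X_le; lra.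
    by have := mulr_ge0 N0 (addr_ge0 e1 e2); move: X_le e1 e2; lra.
  move=> hm; move: ha hb; rewrite /B; lra.
pose t : {ffun 'I_n -> 'I_N.+1} := [ffun j => if j == i then a else s j].
exists t => k j; rewrite big_cons ffunE eqxx.
rewrite (eq_big_seq (fun j => (s j)%:R * v k j 0)) => [|j' j'l]; last first.
  by rewrite ffunE; case: eqP => // E; rewrite -E j'l in il.
have := Ha k; rewrite ge_max => /andP[h1 h2]; rewrite -/(x k) -/(A k).
rewrite inE => /predU1P[->|jl].
  rewrite -/(x k) -mulrA mulrDl mul1r; apply: (le_trans h2).
  by rewrite lerDl mulr_ge0 // (le_trans (nm_ge0 _) h2).
apply: (le_trans (Hs k j jl)); rewrite -/(A k) -mulrA mulrDl mul1r.
have := ler_wpM2l c0 h1; have := le_trans (nm_ge0 _) h1; lra.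
Qed.

Lemma l1norm0_eq v : l1norm v <= 0 -> v = 0.
Proof.
move=> v0; apply: col_eqP => i; rewrite mxE; apply: nm0_eq0.
by apply/eqP; rewrite eq_le nm_ge0 (le_trans (l1norm_coord v i) v0).
Qed.

Lemma l1normB v w : l1norm (v - w) = \sum_i nm (v i 0 - w i 0).
Proof. by apply: eq_bigr => i _; rewrite !mxE. Qed.

Lemma poly_fun_lipschitz p (w0 : 'cV[C]_n) : exists2 K : R, 0 <= K &
  forall w, l1norm (w - w0) <= 1 ->
    nm (poly_fun p w - poly_fun p w0) <= K * l1norm (w - w0).
Proof.
move: p; apply: (poly_fun_ind (P := fun f => exists2 K : R, 0 <= K &
  forall w, l1norm (w - w0) <= 1 -> nm (f w - f w0) <= K * l1norm (w - w0)))
  => [c|i|f g [K K0 fK] [K' K'0 gK]|f g [K K0 fK] [K' K'0 gK]].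
- by exists 0 => // w _; rewrite subrr nm0 mul0r.
- exists 1 => // w _; rewrite mul1r; have := l1norm_coord (w - w0) i.
  by rewrite !mxE.
- exists (K + K') => [|w w1]; first exact: addr_ge0.
  have -> : f w + g w - (f w0 + g w0) = (f w - f w0) + (g w - g w0) by ring.
  by apply: (le_trans (nmD _ _)); rewrite mulrDl lerD ?fK ?gK.
exists (K * (nm (g w0) + K') + nm (f w0) * K') => [|w w1].
  by rewrite addr_ge0 // mulr_ge0 ?addr_ge0 ?nm_ge0.
have -> : f w * g w - f w0 * g w0 =
  (f w - f w0) * (g w0 + (g w - g w0)) + f w0 * (g w - g w0) by ring.
apply: (le_trans (nmD _ _)); rewrite !nmM mulrDl.
have e0 := l1norm_ge0 (w - w0).
have h1 := fK w w1; have h2 := gK w w1.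
apply: lerD; last by rewrite -mulrA ler_wpM2l ?nm_ge0.
rewrite mulrAC; apply: ler_pM; rewrite ?nm_ge0 //.
apply: (le_trans (nmD _ _)); rewrite lerD2l; apply: (le_trans h2).
by rewrite -[leRHS]mulr1 ler_wpM2l.
Qed.

End Groups.

(** * Distance to an orbit in terms of the orbit map *)

Section OrbitMap.
Variables (R : realType) (n : nat).
Local Notation C := R[i].
Local Notation mpol := (mpoly.mpoly n C).
Variables (G : set 'M[C]_n) (L : seq 'M[C]_n) (theta : n.-tuple mpol).
Hypotheses (GG : GL_subgroup G) (GL : enumerates L G) (Gtheta : hsop G theta).
Implicit Types (p q : mpol) (z v w : 'cV[C]_n).

Lemma invariant_comp p : invariant_poly G p ->
  exists q, forall z, poly_fun p z = poly_fun q (poly_map theta z).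
Proof.
have [_ _ _ inv] := Gtheta; move=> /inv[q ->]; exists q => z.
exact: poly_fun_comp.
Qed.

Lemma poly_map_invariant sigma z : G sigma ->
  poly_map theta (sigma *m z) = poly_map theta z.
Proof.
move=> Gs; have [_ inv _ _] := Gtheta; have [Gu _ _ GV] := GG.
apply: col_eqP => i; rewrite !mxE.
have := inv i (invmx sigma) z (GV _ Gs) I; rewrite invmxK //.
Qed.

Lemma min_prod_le (s : seq 'M[C]_n) (h : 'M[C]_n -> R) : s != [::] ->
  (forall x, 0 <= h x) ->
  exists2 x, x \in s & h x ^+ size s <= \prod_(y <- s) h y.
Proof.
move=> sn h0.
have [x xs xmin] : exists2 x, x \in s & forall y, y \in s -> h x <= h y.
  elim: s sn => [//|a s IH] _; have [->|sn] := eqVneq s [::].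
    by exists a; rewrite ?mem_head // => y; rewrite inE => /eqP ->.
  have [x xs xm] := IH sn; have [ax|xa] := leP (h a) (h x).
    exists a; rewrite ?mem_head // => y; rewrite inE => /predU1P[->//|/xm].
    exact: le_trans.
  exists x; rewrite ?inE ?xs ?orbT // => y; rewrite inE => /predU1P[->|/xm //].
  exact: ltW.
exists x => //; elim: s {sn xs} xmin => [|a s IH] xm; first by rewrite big_nil.
rewrite big_cons exprS ler_pM ?exprn_ge0 ?xm ?mem_head // IH // => y ys.
by apply: xm; rewrite inE ys orbT.
Qed.

Lemma prod_le_scale (s : seq 'M[C]_n) (g h : 'M[C]_n -> R) c : 0 <= c ->
  (forall x, x \in s -> 0 <= g x) -> (forall x, x \in s -> g x <= c * h x) ->
  \prod_(x <- s) g x <= c ^+ size s * \prod_(x <- s) h x.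
Proof.
move=> c0; elim: s => [|a s IH] g0 gh; first by rewrite !big_nil expr0 mulr1.
have sub x : x \in s -> x \in a :: s by rewrite inE => ->; rewrite orbT.
rewrite !big_cons exprS mulrACA ler_pM ?g0 ?gh ?mem_head //.
- by rewrite big_seq; apply: prodr_ge0 => x /sub/g0.
- by apply: IH => x /sub; [apply: g0 | apply: gh].
Qed.

(** The orbit map is finite-to-one in a quantitative way: [z] lies as close to
    the orbit of [z0] as [|theta z - theta z0| ^ (1 / N)].  Indeed
    [prod_rho l (z0 - rho z)], for a linear form [l], is an invariant
    polynomial in [z] that vanishes at [z0]. *)
Lemma orbit_map_hoelder z0 : exists2 K : R, 0 <= K & forall z,
  l1norm (poly_map theta z - poly_map theta z0) <= 1 ->
  exists2 rho, G rho & l1norm (z0 - rho *m z) ^+ size L <=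
    K * l1norm (poly_map theta z - poly_map theta z0).
Proof.
pose N := size L; pose N1 := #|'I_N|.+1.
pose lin (s : {ffun 'I_n -> 'I_N1}) : mpol := \sum_i mcst n (s i)%:R * (mcst n (z0 i 0) - mvar R[i] i).
pose F s : mpol := \prod_(rho <- L) affine_comp rho 0 (lin s).
have FE s z : poly_fun (F s) z = \prod_(rho <- L) linform s (z0 - rho *m z).
  rewrite /F poly_fun_prod; apply: eq_bigr => rho _.
  rewrite poly_fun_affine addr0 /lin poly_fun_sum; apply: eq_bigr => i _.
  by rewrite poly_funM poly_funB !poly_fun_mcst poly_fun_mvar !mxE.
have Finv s : invariant_poly G (F s).
  move=> sigma z Gs _; rewrite !FE.
  exact: (invariant_big GG GL _ (fun y => linform s (z0 - y))).
have /choice[q qE] : forall s, exists q, forall z,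
    poly_fun (F s) z = poly_fun q (poly_map theta z).
  by move=> s; apply: invariant_comp.
have /choice[K KP] : forall s, exists K : R, 0 <= K /\
    forall w, l1norm (w - poly_map theta z0) <= 1 ->
    nm (poly_fun (q s) w - poly_fun (q s) (poly_map theta z0)) <=
      K * l1norm (w - poly_map theta z0).
  by move=> s; have [K K0 KP] := poly_fun_lipschitz (q s) (poly_map theta z0); exists K.
have [c c0 Hc] := generic_linform R n 'I_N.
have K0 : 0 <= \sum_s K s by apply: sumr_ge0 => s _; case: (KP s).
exists (c ^+ N * \sum_s K s) => [|z zd]; first by rewrite mulr_ge0 ?exprn_ge0.
have [s Hs] := Hc (fun k => z0 - tnth (in_tuple L) k *m z).
have Ln : L != [::] by have := unit_in_enum GG GL; case: (L).
have [rho rhoL le] := min_prod_le Ln (fun rho => l1norm_ge0 (z0 - rho *m z)).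
exists rho; first exact/GL.2.
apply: (le_trans le).
have prod_le : \prod_(rho <- L) l1norm (z0 - rho *m z) <=
    c ^+ N * nm (poly_fun (F s) z).
  rewrite FE nm_prod; apply: prod_le_scale => // [r1 _|rho' rL].
    exact: l1norm_ge0.
  have k_lt : (index rho' L < size L)%N by rewrite index_mem.
  by have := Hs (Ordinal k_lt); rewrite (tnth_nth 0) /= nth_index.
apply: (le_trans prod_le); rewrite -mulrA ler_wpM2l ?exprn_ge0 //.
have F0 : poly_fun (q s) (poly_map theta z0) = 0.
  rewrite -qE FE (big_rem 1%:M) ?(unit_in_enum GG GL) //= mul1mx subrr.
  by rewrite /linform big1 ?mul0r // => i _; rewrite mxE mulr0.
have [Ks0 Ks] := KP s; have := Ks _ zd; rewrite F0 subr0 -qE => h.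
apply: (le_trans h); rewrite ler_wpM2r ?l1norm_ge0 // (bigD1 s) //= lerDl.
by apply: sumr_ge0 => s' _; case: (KP s').
Qed.

(** The case [theta z = theta z0] of [orbit_map_hoelder]. *)
Lemma orbit_map_separates z z0 : poly_map theta z = poly_map theta z0 ->
  exists2 rho, G rho & z0 = rho *m z.
Proof.
move=> E; have [K K0 H] := orbit_map_hoelder z0.
have N0 : l1norm (poly_map theta z - poly_map theta z0) = 0.
  by rewrite E l1normB big1 // => i _; rewrite subrr nm0.
have [|rho Gr] := H z; first by rewrite N0.
rewrite N0 mulr0 => h; exists rho => //; apply/eqP; rewrite -subr_eq0; apply/eqP.
apply: l1norm0_eq; rewrite leNgt; apply/negP => /(exprn_gt0 (size L)).
by rewrite ltNge h.
Qed.

End OrbitMap.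

(** * Surjectivity of the orbit map *)

Lemma subr_mul_split (T : comPzRingType) (x y a b : T) :
  x * y - a * b = y * (x - a) + a * (y - b).
Proof. ring. Qed.

Section Nullstellensatz.
Variables (R : realType) (n : nat).
Local Notation C := R[i].
Local Notation mpol := (mpoly.mpoly n C).
Implicit Types (p q : mpol) (I J : mpol -> Prop) (w : 'cV[C]_n).

Definition ideal I := [/\ I 0, forall p q, I p -> I q -> I (p + q)
  & forall a p, I p -> I (a * p)].

Definition adjoin I q : mpol -> Prop := fun p => exists a b, I a /\ p = a + b * q.

Lemma ideal_adjoin I q : ideal I -> ideal (adjoin I q).
Proof.
move=> [I0 ID IM]; split=> [|p p' [a [b [Ia ->]]] [a' [b' [Ia' ->]]]|c p [a [b [Ia ->]]]].
- by exists 0, 0; split => //; rewrite mul0r addr0.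
- by exists (a + a'), (b + b'); split; [exact: ID | ring].
- by exists (c * a), (c * b); split; [exact: IM | ring].
Qed.

Lemma sub_adjoin I q p : I p -> adjoin I q p.
Proof. by move=> Ip; exists p, 0; rewrite mul0r addr0. Qed.

Lemma adjoin_gen I q : ideal I -> adjoin I q q.
Proof. by move=> [I0 _ _]; exists 0, 1; rewrite add0r mul1r. Qed.

(** Otherwise 1 is congruent modulo [I] to a multiple of each factor; multiplying
    these congruences puts 1 in [I]. *)
Lemma adjoin_factor I (x : mpol) (cs : seq C) : ideal I -> ~ I 1 ->
  I (\prod_(c <- cs) (x - mcst n c)) ->
  exists c, ~ adjoin I (x - mcst n c) 1.
Proof.
move=> II I1 Iprod; apply: contrapT => H; apply: I1.
have all1 c : adjoin I (x - mcst n c) 1.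
  by apply: contrapT => h; apply: H; exists c.
have [I0 ID IM] := II.
have [a [b [Ia ->]]] : adjoin I (\prod_(c <- cs) (x - mcst n c)) 1.
  elim: (cs) => [|c s [a [b [Ia E]]]].
    by exists 0, 1; rewrite big_nil add0r mul1r.
  have [a' [b' [Ia' E']]] := all1 c; rewrite big_cons.
  set P := \prod_(_ <- _) _ in E *.
  exists (a' + b' * (x - mcst n c) * a), (b' * b); split.
    by apply: ID => //; apply: IM.
  have H' : b' * (x - mcst n c) = b' * (x - mcst n c) * (a + b * P).
    by rewrite -E mulr1.
  by rewrite {1}E' {1}H'; ring.
by apply: ID => //; apply: IM.
Qed.

(** A weak Nullstellensatz: roots are adjoined to the ideal one variable at a
    time, and modulo the final ideal every polynomial is congruent to its value
    at a point, so that the members of [I] vanish there. *)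
Lemma common_zero I : ideal I -> ~ I 1 ->
  (forall i, exists cs : seq C, I (\prod_(c <- cs) (mvar R[i] i - mcst n c))) ->
  exists c : 'cV[C]_n, forall p, I p -> poly_fun p c = 0.
Proof.
move=> II I1 Iroots.
have [J [JI [J1 [IJ [c cP]]]]] : exists J, ideal J /\ ~ J 1 /\
    (forall p, I p -> J p) /\ exists c : 'I_n -> C, forall i, J (mvar R[i] i - mcst n (c i)).
  suff : forall l : seq 'I_n, exists J, ideal J /\ ~ J 1 /\ (forall p, I p -> J p) /\
      exists c : 'I_n -> C, forall i, i \in l -> J (mvar R[i] i - mcst n (c i)).
    move=> /(_ (index_enum 'I_n))[J [JI [J1 [IJ [c cP]]]]].
    by exists J; do 3!split => //; exists c => i; apply: cP; apply: mem_index_enum.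
  elim=> [|i l [J [JI [J1 [IJ [c cP]]]]]].
    by exists I; do 3!split => //; exists (fun=> 0).
  have [cs /IJ Jcs] := Iroots i.
  have [d d1] := adjoin_factor JI J1 Jcs.
  exists (adjoin J (mvar R[i] i - mcst n d)); split; first exact: ideal_adjoin.
  split => //; split; first by move=> p /IJ; apply: sub_adjoin.
  exists (fun j => if j == i then d else c j) => j.
  have [->|ji] := eqVneq j i; first by move=> _; apply: adjoin_gen.
  by rewrite inE (negbTE ji) => /cP; apply: sub_adjoin.
have [J0 JD JM] := JI.
pose z : 'cV[C]_n := \col_i c i.
have Jeval p : J (p - mcst n (poly_fun p z)).
  elim/mpoly_ring_ind: p => [a|i|p q Jp Jq|p q Jp Jq].
  - by rewrite poly_fun_mcst subrr.
  - by rewrite poly_fun_mvar mxE.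
  - rewrite poly_funD /mcst mpoly.mpolyCD opprD addrACA; exact: JD.
  - rewrite poly_funM /mcst mpoly.mpolyCM.
    rewrite subr_mul_split.
    by apply: JD; apply: JM.
exists z => p /IJ Jp; apply/eqP; apply: contraT => pz; case: J1.
have Jc : J (mcst n (poly_fun p z)).
  have -> : mcst n (poly_fun p z) = p + (-1) * (p - mcst n (poly_fun p z)) by ring.
  by apply: JD => //; apply: JM.
have := JM (mcst n (poly_fun p z)^-1) _ Jc.
by rewrite /mcst -mpoly.mpolyCM mulVf // mpoly.mpolyC1.
Qed.

End Nullstellensatz.

Section Surjectivity.
Variables (R : realType) (n : nat).
Local Notation C := R[i].
Local Notation mpol := (mpoly.mpoly n C).
Variables (G : set 'M[C]_n) (L : seq 'M[C]_n) (theta : n.-tuple mpol).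
Hypotheses (GG : GL_subgroup G) (GL : enumerates L G) (Gtheta : hsop G theta).
Implicit Types (p q : mpol) (z v w : 'cV[C]_n).

Definition fibre_ideal w : mpol -> Prop := fun p =>
  exists b : 'I_n -> mpol, p = \sum_i b i * (tnth theta i - mcst n (w i 0)).

Lemma ideal_fibre w : ideal (fibre_ideal w).
Proof.
split=> [|p q [b ->] [b' ->]|a p [b ->]].
- by exists (fun=> 0); rewrite big1 // => i _; rewrite mul0r.
- exists (fun i => b i + b' i); rewrite -big_split /=.
  by apply: eq_bigr => i _; rewrite mulrDl.
- exists (fun i => a * b i); rewrite mulr_sumr.
  by apply: eq_bigr => i _; rewrite mulrA.
Qed.

(** If 1 were a combination of the [theta i - w i], averaging the coefficients
    over the group would give such a relation with invariant coefficients, that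
    is, a relation between polynomials evaluated at [theta]; algebraic
    independence allows to specialize [theta] to [w]. *)
Lemma fibre_ideal_proper w : ~ fibre_ideal w 1.
Proof.
move=> [b bE].
pose B i : mpol := \sum_(rho <- L) affine_comp rho 0 (b i).
have BE i z : poly_fun (B i) z = \sum_(rho <- L) poly_fun (b i) (rho *m z).
  by rewrite poly_fun_sum; apply: eq_bigr => rho _; rewrite poly_fun_affine addr0.
have [_ inv indep invP] := Gtheta.
have /choice[q qE] : forall i, exists q, B i = mpoly.comp_mpoly theta q.
  move=> i; apply/invP => sigma z Gs _; rewrite !BE.
  exact: (invariant_big GG GL _ (fun y => poly_fun (b i) y)).
pose Q : mpol := mcst n (size L)%:R - \sum_i q i * (mvar R[i] i - mcst n (w i 0)).
have Q0 : Q = 0.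
  apply: indep; apply: poly_fun_inj => z; rewrite poly_fun_comp poly_fun0.
  rewrite poly_funB poly_fun_mcst poly_fun_sum.
  rewrite (eq_bigr (fun i => poly_fun (B i) z * (poly_fun (tnth theta i) z - w i 0))).
    2: by move=> i _; rewrite poly_funM poly_funB poly_fun_mvar poly_fun_mcst mxE qE poly_fun_comp.
  have one rho : G rho -> 1 = \sum_i poly_fun (b i) (rho *m z) * (poly_fun (tnth theta i) z - w i 0).
    move=> Gr; have := congr1 (fun p => poly_fun p (rho *m z)) bE.
    rewrite /= poly_fun1 poly_fun_sum => ->; apply: eq_bigr => i _.
    rewrite poly_funM poly_funB poly_fun_mcst; congr (_ * (_ - _)).
    by have := congr1 (fun v => v i 0) (poly_map_invariant GG Gtheta z Gr); rewrite !mxE.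
  have -> : (size L)%:R = \sum_(rho <- L) (1 : C).
    by rewrite big_const_seq count_predT iter_addr addr0.
  apply/eqP; rewrite subr_eq0; apply/eqP.
  rewrite (eq_big_seq _ (fun rho h => one rho ((GL.2 rho).2 h))) exchange_big /=.
  by apply: eq_bigr => i _; rewrite BE mulr_suml.
have := congr1 (fun p => poly_fun p w) Q0.
rewrite /= poly_fun0 poly_funB poly_fun_mcst poly_fun_sum big1 => [|i _].
  move=> /eqP; rewrite subr0 pnatr_eq0 size_eq0 => /eqP L0.
  by have := unit_in_enum GG GL; rewrite L0.
by rewrite poly_funM poly_funB poly_fun_mvar poly_fun_mcst subrr mulr0.
Qed.

(** Modulo the ideal, [theta i] is congruent to [w i]. *)
Lemma fibre_ideal_comp w q :
  fibre_ideal w (mpoly.comp_mpoly theta q - mcst n (poly_fun q w)).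
Proof.
have [J0 JD JM] := ideal_fibre w.
elim/mpoly_ring_ind: q => [a|i|p q Jp Jq|p q Jp Jq].
- by rewrite poly_fun_mcst mpoly.comp_mpolyC subrr.
- rewrite poly_fun_mvar mpoly.comp_mpolyXU.
  exists (fun j => (j == i)%:R); rewrite (bigD1 i) //= eqxx mul1r big1 ?addr0.
    by rewrite (tnth_nth 0).
  by move=> j ji; rewrite (negbTE ji) mul0r.
- by rewrite poly_funD /mcst mpoly.mpolyCD rmorphD /= opprD addrACA; exact: JD.
- rewrite poly_funM /mcst mpoly.mpolyCM rmorphM /=.
  rewrite subr_mul_split.
  by apply: JD; apply: JM.
Qed.

(** The coordinate [z_i] is a root of [prod_rho (X - (rho z)_i)], whose
    coefficients are invariant. *)
Lemma fibre_ideal_split w i : exists cs : seq C,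
  fibre_ideal w (\prod_(c <- cs) (mvar R[i] i - mcst n c)).
Proof.
have [J0 JD JM] := ideal_fibre w.
pose x rho : mpol := affine_comp rho 0 (mvar R[i] i).
pose A : {poly mpol} := \prod_(rho <- L) ('X - (x rho)%:P).
have sA : size A = (size L).+1 by rewrite size_prod_XsubC.
have Amon : A \is monic by apply: monic_prod_XsubC.
have [_ _ _ invP] := Gtheta.
have /choice[q qE] : forall k, exists q, A`_k = mpoly.comp_mpoly theta q.
  move=> k; apply/invP => sigma z Gs _.
  have ev y : poly_fun A`_k y = (\prod_(rho <- L) ('X - (poly_fun (mvar R[i] i) (rho *m y))%:P))`_k.
    have evA : map_poly (mpoly.meval (fun j => y j 0)) A =
        \prod_(rho <- L) ('X - (poly_fun (mvar R[i] i) (rho *m y))%:P).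
      rewrite rmorph_prod; apply: eq_bigr => rho _.
      rewrite rmorphB /= map_polyX map_polyC /= -/(poly_fun _ _).
      by rewrite poly_fun_affine addr0.
    by rewrite -evA coef_map.
  rewrite ev [RHS]ev; apply: (congr1 (fun V : {poly C} => V`_k)).
  pose h y : {poly C} := 'X - (poly_fun (mvar R[i] i) y)%:P.
  exact: (invariant_big GG GL *%R h z Gs).
pose U : {poly C} := 'X^(size L) + \poly_(k < size L) poly_fun (q k) w.
have Umon : U \is monic.
  rewrite monicE lead_coefDl ?lead_coefXn // size_polyXn ltnS; exact: size_poly.
have [cs csE] := closed_field_poly_normal U.
exists cs; rewrite (monicP Umon) scale1r in csE.
have -> : \prod_(c <- cs) (mvar R[i] i - mcst n c) =
   mvar R[i] i ^+ size L + \sum_(k < size L) mcst n (poly_fun (q k) w) * mvar R[i] i ^+ k.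
  have := congr1 (fun V => (map_poly (@mpoly.mpolyC n C) V).[mvar R[i] i]) csE.
  rewrite /= rmorph_prod /= horner_prod => E.
  rewrite [LHS](_ : _ = \prod_(c <- cs) (map_poly (@mpoly.mpolyC n C) ('X - c%:P)).[mvar R[i] i]).
    rewrite -E /U rmorphD /= map_polyXn hornerD hornerXn; congr (_ + _).
    rewrite poly_def rmorph_sum /= horner_sum; apply: eq_bigr => k _.
    by rewrite -mul_polyC rmorphM /= map_polyC map_polyXn /= hornerM hornerC hornerXn.
  by apply: eq_bigr => c _; rewrite rmorphB /= map_polyX map_polyC /= hornerXsubC.
have A0 : A.[mvar R[i] i] = 0.
  rewrite /A (big_rem 1%:M) ?(unit_in_enum GG GL) //= hornerM hornerXsubC.
  have -> : x 1%:M = mvar R[i] i.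
    by apply: poly_fun_inj => z; rewrite poly_fun_affine mul1mx addr0.
  by rewrite subrr mul0r.
have lead : A`_(size L) = 1 by have := monicP Amon; rewrite lead_coefE sA.
rewrite horner_coef sA big_ord_recr /= lead mul1r addrC in A0.
move/eqP: A0; rewrite addr_eq0 => /eqP.
move=> ->; rewrite addrC -sumrB.
elim/big_ind: _ => // k _; rewrite -mulrBl mulrC; apply: (JM).
rewrite qE -opprB -mulN1r; apply: JM; exact: fibre_ideal_comp.
Qed.

(** The zeros of the ideal generated by the [theta i - w i] form the fibre over
    [w]. *)
Lemma orbit_map_surjective w : exists z, poly_map theta z = w.
Proof.
have [z zP] := common_zero (ideal_fibre w) (@fibre_ideal_proper w)
  (fibre_ideal_split w).
exists z; apply: col_eqP => i; rewrite mxE; apply/eqP; rewrite -subr_eq0.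
rewrite -[w i 0](poly_fun_mcst (w i 0) z) -poly_funB; apply/eqP/zP.
exists (fun j => (j == i)%:R); rewrite (bigD1 i) //= eqxx mul1r big1 ?addr0 //.
by move=> j ji; rewrite (negbTE ji) mul0r.
Qed.

End Surjectivity.

(** * Frechet differentiability *)

Section SecondOrderContact.
Variables (K : numFieldType) (V W : normedModType K).
Implicit Types (f g q : V -> W) (z w h : V) (e d k : K).

Lemma differentiable_expansion f z : differentiable f z ->
  exists df : {linear V -> W}, forall e, 0 < e ->
    exists2 d, 0 < d & forall h, `|h| < d ->
      `|f (h + z) - f z - df h| <= e * `|h|.
Proof.
move=> fd; exists ('d f z) => e e0.
have /eqaddoP/(_ _ e0) := diff_locally fd.
move=> /nbhs_norm0P[d d0 H]; exists d => // h /H hd.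
by rewrite -addrA -opprD; exact: hd.
Qed.

Lemma differentiable_small g w : g w = 0 ->
  (forall e, 0 < e -> exists2 d, 0 < d & forall h, `|h| < d ->
     `|g (h + w)| <= e * `|h|) -> differentiable g w.
Proof.
move=> g0 H.
have E : g \o shift w = cst (g w) + (\0 : {linear V -> W}) +o_ 0 id.
  apply/eqaddoP => e e0; have [d d0 Hd] := H e e0.
  apply/nbhs_norm0P; exists d => // h /Hd /=.
  rewrite g0; congr (`|_| <= _).
  by rewrite -[RHS]/(g (h + w) - (0 + 0)) addr0 subr0.
have c0 : continuous (\0 : {linear V -> W}) by move=> x; apply: cst_continuous.
by apply/diff_locallyP; rewrite (diff_unique c0 E).
Qed.

Lemma differentiable_quadratic g q w (k d : K) : differentiable q w ->
  0 <= k -> 0 < d ->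
  (forall h, `|h| < d -> `|g (h + w) - q (h + w)| <= k * `|h| ^+ 2) ->
  differentiable g w.
Proof.
move=> qd k0 d0 H.
rewrite (_ : g = q + (fun x => g x - q x)); last first.
  by apply: funext => x; rewrite /= -[RHS]/(q x + (g x - q x)) subrKC.
apply: differentiableD => //; apply: differentiable_small => [|e e0].
  have := H 0; rewrite normr0 => /(_ d0); rewrite expr0n mulr0 add0r normr_le0.
  by move/eqP.
have k1 : 0 < k + 1 by rewrite ltr_wpDl.
have ek0 : 0 < e / (k + 1) by rewrite divr_gt0.
have [m m0 [md me]] : exists2 m, 0 < m & m <= d /\ m <= e / (k + 1).
  have [le|/ltW le] := real_leP (gtr0_real d0) (gtr0_real ek0).
    by exists d.
  by exists (e / (k + 1)).
exists m => // h hm; have hd := lt_le_trans hm md; have he := lt_le_trans hm me.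
apply: (le_trans (H h hd)); rewrite expr2 mulrA ler_wpM2r //.
apply: (@le_trans _ _ ((k + 1) * `|h|)); first by rewrite ler_wpM2r // lerDl.
by rewrite mulrC -ler_pdivlMr // ltW.
Qed.

End SecondOrderContact.

Section FrechetDifferentiability.
Variables (K : numClosedFieldType) (n : nat).
Implicit Types (f g q : 'cV[K]_n -> K) (z w h : 'cV[K]_n) (e d : K).

Lemma col_norm_coord h i : `|h i 0| <= `|h|.
Proof.
have H : `|h i 0|%:nng%:num <=
    (\big[Num.max/0%:nng]_(ij : 'I_n * 'I_1) `|h ij.1 ij.2|%:nng)%:num.
  by rewrite num_le; apply: (le_bigmax _ (fun ij => `|h ij.1 ij.2|%:nng) (i, 0)).
by rewrite [leRHS]/Num.Def.normr /= mx_normE.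
Qed.

Lemma col_norm_le h e : 0 <= e -> (forall i, `|h i 0| <= e) -> `|h| <= e.
Proof.
move=> /nonnegP[{}e] he; rewrite [leLHS]/Num.Def.normr /= mx_normE num_le.
apply/bigmax_leP; split => [|[i j] _]; first by rewrite -num_le /=.
by rewrite -num_le /= ord1.
Qed.

Lemma domain_near (U : set 'cV[K]_n) z : domain U -> U z ->
  exists2 d, 0 < d & forall w, `|w - z| < d -> U w.
Proof.
move=> [_ oU _] Uz; have /nbhs_normP[d d0 H] := open_nbhs_nbhs (conj oU Uz).
by exists d => // w wz; apply: H; rewrite /= distrC.
Qed.

Lemma holomorphic_bounded_near (U : set 'cV[K]_n) f z : holomorphic_on U f -> U z ->
  exists2 d, 0 < d & forall w, `|w - z| < d -> `|f w - f z| <= 1.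
Proof.
move=> fh Uz; have := differentiable_continuous (fh z Uz).
move=> /cvgrPdist_le/(_ 1 ltr01)/nbhs_normP[d d0 H].
exists d => // w wz; rewrite distrC; apply: H.
by rewrite /= distrC.
Qed.

Lemma differentiable_poly_fun (p : mpoly.mpoly n K) w : differentiable (poly_fun p) w.
Proof.
move: p; apply: (poly_fun_ind (P := fun f => differentiable f w)) => [c|i|f g fd gd|f g fd gd].
- exact: differentiable_cst.
- exact: differentiable_coord.
- exact: (differentiableD fd gd).
- exact: (differentiableM fd gd).
Qed.

Lemma holomorphic_of_contact (U : set 'cV[K]_n) g :
  (forall w, U w -> exists p k d, [/\ 0 <= k, 0 < d & forall h, `|h| < d ->
     `|g (h + w) - poly_fun p (h + w)| <= k * `|h| ^+ 2]) -> holomorphic_on U g.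
Proof.
move=> H w /H[p [k [d [k0 d0 Hd]]]].
exact: (differentiable_quadratic (differentiable_poly_fun p w) k0 d0 Hd).
Qed.

End FrechetDifferentiability.

(** * Approximation by invariant polynomials *)

Section LocalApproximation.
Variables (R : realType) (n : nat).
Local Notation C := R[i].
Local Notation mpol := (mpoly.mpoly n C).
Implicit Types (f : 'cV[C]_n -> C) (z w h : 'cV[C]_n) (Omega : set 'cV[C]_n).
Implicit Types (p q : mpol).

Lemma pos_complex (d : C) : 0 < d -> exists2 r : R, 0 < r & d = r%:C.
Proof.
move=> d0; exists (Re d); last by rewrite RRe_real // gtr0_real.
by rewrite -ltcR RRe_real // gtr0_real.
Qed.

Lemma polydisc_norm (r : R) h : 0 <= r -> polydisc r h -> `|h| <= r%:C.
Proof.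
by move=> r0 hr; apply: col_norm_le => [|i]; rewrite ?ler0c // normE lecR ltW ?hr.
Qed.

Lemma holomorphic_slice Omega f z i : holomorphic_on Omega f -> Omega z ->
  cdiff (fun t => f (upd z i t)) (z i 0).
Proof.
move=> fh Oz; have [df H] := differentiable_expansion (fh z Oz).
exists (df (delta_mx i 0)) => e e0.
have [|d d0 Hd] := H e%:C; first by rewrite ltcR.
have [r r0 dE] := pos_complex d0; exists r => // t tr.
have nt : `|t *: (delta_mx i 0 : 'cV[C]_n)| <= (nm t)%:C.
  apply: col_norm_le => [|j]; first by rewrite ler0c nm_ge0.
  rewrite !mxE normE lecR nmM; case: (j == i); rewrite ?nm1 ?mulr1 //.
  by rewrite nm0 mulr0 nm_ge0.
have /Hd : `|t *: (delta_mx i 0 : 'cV[C]_n)| < d.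
  by apply: (le_lt_trans nt); rewrite dE ltcR.
have -> : t *: delta_mx i 0 + z = upd z i (z i 0 + t).
  apply: col_eqP => j; rewrite updE !mxE andbT addrC.
  by case: eqP => [->|_]; rewrite ?mulr1 // mulr0 addr0.
rewrite upd_id linearZ /= => h; have e0C : 0 <= e%:C by rewrite ler0c ltW.
have := le_trans h (ler_wpM2l e0C nt); rewrite normE (mulrC (df _) t).
by rewrite -(rmorphM (real_complex R)) lecR.
Qed.

Lemma holomorphic_near Omega f z : domain Omega -> holomorphic_on Omega f ->
  Omega z -> exists2 r : R, 0 < r & forall w, polydisc r (w - z) ->
    Omega w /\ nm (f w) <= nm (f z) + 1.
Proof.
move=> oO fh Oz.
have [d1 d10 H1] := domain_near oO Oz.
have [d2 d20 H2] := holomorphic_bounded_near fh Oz.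
have [r1 r10 E1] := pos_complex d10; have [r2 r20 E2] := pos_complex d20.
exists (Num.min r1 r2 / 2); first by rewrite divr_gt0 // lt_min r10.
set r := Num.min r1 r2 / 2; have m0 : 0 < Num.min r1 r2 by rewrite lt_min r10.
have [rr1 rr2] : r < r1 /\ r < r2.
  have : Num.min r1 r2 <= r1 by rewrite ge_min lexx.
  have : Num.min r1 r2 <= r2 by rewrite ge_min lexx orbT.
  by rewrite /r; split; lra.
have r0 : 0 <= r by rewrite /r; lra.
move=> w wr; have wn := polydisc_norm r0 wr; split.
  by apply: H1; rewrite (le_lt_trans wn) // E1 ltcR.
have := H2 w; rewrite (le_lt_trans wn) ?E2 ?ltcR // => /(_ isT).
rewrite normE -[1]/(1%:C) lecR => h.
by have := nmD (f w - f z) (f z); rewrite subrK; lra.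
Qed.

Lemma cdiff_shift (F : C -> C) x a : cdiff F (x + a) -> cdiff (fun t => F (t + a)) x.
Proof.
move=> [d Fd]; exists d => e /Fd[del del0 H]; exists del => // t /H.
by rewrite (addrAC x t a).
Qed.

Lemma holomorphic_poly_approx Omega f z0 k : domain Omega -> holomorphic_on Omega f ->
  Omega z0 -> exists p K del, [/\ 0 <= K, 0 < del & forall w,
    l1norm (w - z0) < del ->
    Omega w /\ nm (f w - poly_fun p w) <= K * l1norm (w - z0) ^+ k].
Proof.
move=> oO fh Oz; have [r r0 H] := holomorphic_near oO fh Oz.
pose F h := f (h + z0).
have FS : sephol r (nm (f z0) + 1) F.
  move=> h hr; have [|Oh hM] := H (h + z0); first by rewrite addrK.
  split => // i; have := holomorphic_slice i fh Oh.
  rewrite mxE => /cdiff_shift; congr (cdiff _ _); apply: funext => t.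
  rewrite /F; congr f; apply: col_eqP => j; rewrite !mxE.
  by case: eqP => // ->.
have M0 : 0 <= nm (f z0) + 1 by have := nm_ge0 (f z0); lra.
have [|p [K [del [K0 del0 Hp]]]] := sephol_poly_approx (l := index_enum 'I_n) k r0 M0 FS.
  by move=> z w zw; congr F; apply: col_eqP => i; apply: zw; apply: mem_index_enum.
exists (affine_comp 1%:M (- z0) p), K, (Num.min r del); split => //.
  by rewrite lt_min r0.
move=> w; rewrite lt_min => /andP[wr wd].
have pd s : l1norm (w - z0) < s -> polydisc s (w - z0).
  by move=> ws i; apply: le_lt_trans ws; apply: l1norm_coord.
split; first by case: (H w (pd _ wr)).
have := Hp (w - z0) (pd _ wd); rewrite /F subrK.
by rewrite poly_fun_affine mul1mx.
Qed.

Definition vanishes k z p := exists2 K : R, 0 <= K & forall w,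
  l1norm (w - z) <= 1 -> nm (poly_fun p w) <= K * l1norm (w - z) ^+ k.

Lemma vanishes_power k z p : poly_fun p z = 0 -> vanishes k z (p ^+ k).
Proof.
move=> pz; have [K K0 H] := poly_fun_lipschitz p z.
exists (K ^+ k) => [|w wz]; first exact: exprn_ge0.
have := H w wz; rewrite pz subr0 => h.
by rewrite poly_funX nmX -exprMn lerXn2r ?nnegrE ?nm_ge0 ?mulr_ge0 ?l1norm_ge0.
Qed.

Lemma vanishes_mul k z p q : vanishes k z p -> vanishes k z (p * q).
Proof.
move=> [K K0 H]; have [K' K'0 H'] := poly_fun_lipschitz q z.
have q0 := nm_ge0 (poly_fun q z).
exists (K * (nm (poly_fun q z) + K')) => [|w wz]; first by rewrite mulr_ge0 ?addr_ge0.
rewrite poly_funM nmM mulrAC; apply: ler_pM; rewrite ?nm_ge0 ?H //.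
have := nmD (poly_fun q w - poly_fun q z) (poly_fun q z); rewrite subrK.
have := ler_wpM2l K'0 wz; have := H' w wz; lra.
Qed.

(** If [u] is 1 at [z0] and vanishes to order [k] at the other points, then
    [u * sum_(j < k) (1 - u) ^ j = 1 - (1 - u) ^ k] has both properties to order
    [k]. *)
Lemma cutoff k z0 (ys : seq 'cV[C]_n) : exists chi : mpol,
  vanishes k z0 (1 - chi) /\
  forall y, y \in ys -> y != z0 -> vanishes k y chi.
Proof.
have /choice[a aP] : forall y : 'cV[C]_n, exists p, poly_fun p z0 = 1 /\
    (y != z0 -> poly_fun p y = 0).
  move=> y; have [->|yz] := eqVneq y z0; first by exists 1; rewrite poly_fun1.
  have [i yi] : exists i, y i 0 != z0 i 0.
    apply: contrapT => H; case/eqP: yz; apply: col_eqP => i; apply/eqP.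
    by apply: contraT => h; case: H; exists i.
  exists (mcst n (z0 i 0 - y i 0)^-1 * (mvar C i - mcst n (y i 0))).
  rewrite !poly_funM !poly_funB !poly_fun_mcst !poly_fun_mvar subrr mulr0.
  by rewrite mulVf // subr_eq0 eq_sym.
pose e : mpol := \prod_(y <- ys) a y.
have e1 : poly_fun e z0 = 1.
  by rewrite poly_fun_prod big1 // => y _; case: (aP y).
have e0 y : y \in ys -> y != z0 -> poly_fun e y = 0.
  move=> ys_y yz; rewrite poly_fun_prod (big_rem y) //= (aP y).2 //.
  by rewrite mul0r.
pose u := e ^+ k; pose S : mpol := \sum_(j < k) (1 - u) ^+ j.
have E : 1 - u * S = (1 - u) ^+ k.
  have := subrX1 (1 - u) k; rewrite -/S => h.
  by rewrite -[RHS](subrK 1) h; ring.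
exists (u * S); split=> [|y ys_y yz].
  by rewrite E; apply: vanishes_power; rewrite poly_funB poly_fun1 poly_funX e1 expr1n subrr.
by apply: vanishes_mul; apply: vanishes_power; apply: e0.
Qed.

Lemma l1norm_mulmx (A : 'M[C]_n) : exists2 c : R, 0 < c &
  forall v, l1norm (A *m v) <= c * l1norm v.
Proof.
exists (\sum_i \sum_j nm (A i j) + 1) => [|v].
  rewrite ltr_wpDl // sumr_ge0 // => i _; rewrite sumr_ge0 // => j _; exact: nm_ge0.
rewrite mulrDl mul1r; apply: (@le_trans _ _ ((\sum_i \sum_j nm (A i j)) * l1norm v)); last first.
  by rewrite lerDl l1norm_ge0.
rewrite mulr_suml; apply: ler_sum => i _; rewrite mxE mulr_suml.
apply: (le_trans (nm_sum _ _ _)); apply: ler_sum => j _; rewrite nmM.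
by rewrite ler_wpM2l ?nm_ge0 ?l1norm_coord.
Qed.

(** Multiplying a Taylor polynomial at [z0] by a cutoff that removes the other
    points of the orbit, and summing over the group, yields an invariant
    approximation. *)
Lemma invariant_poly_approx (G : set 'M[C]_n) (L : seq 'M[C]_n) Omega f z0 k :
  GL_subgroup G -> enumerates L G -> domain Omega -> holomorphic_on Omega f ->
  invariant_fun G Omega f -> Omega z0 ->
  exists p K del, [/\ invariant_poly G p, 0 <= K, 0 < del & forall w,
    l1norm (w - z0) < del ->
    Omega w /\ nm (f w - poly_fun p w) <= K * l1norm (w - z0) ^+ k].
Proof.
move=> GG GL oO fh finv Oz.
have [p [K [del [K0 del0 Hp]]]] := holomorphic_poly_approx k oO fh Oz.
have [chi [chi1 chi0]] := cutoff k z0 [seq rho *m z0 | rho <- L].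
pose p1 := chi * p.
have [K1 K10 H1] := vanishes_mul p chi1.
pose m := count (fun rho => rho *m z0 == z0) L.
have m0 : (0 < m)%N.
  rewrite -has_count; apply/hasP; exists 1%:M; first exact: (unit_in_enum GG GL).
  by rewrite mul1mx.
have each rho : G rho -> exists K' d', [/\ 0 <= K', 0 < d' & forall w,
    l1norm (w - z0) < d' -> nm ((if rho *m z0 == z0 then f w else 0)
      - poly_fun p1 (rho *m w)) <= K' * l1norm (w - z0) ^+ k].
  move=> Gr; have [c c0 Hc] := l1norm_mulmx rho.
  have near w : l1norm (rho *m w - rho *m z0) <= c * l1norm (w - z0).
    by rewrite -mulmxBr; apply: Hc.
  have pow w K' : 0 <= K' -> K' * l1norm (rho *m w - rho *m z0) ^+ k <=
      K' * c ^+ k * l1norm (w - z0) ^+ k.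
    move=> K'0; rewrite -mulrA -exprMn ler_wpM2l // lerXn2r ?nnegrE ?l1norm_ge0 //.
    by rewrite mulr_ge0 ?l1norm_ge0 // ltW.
  have [rz|rz] := eqVneq (rho *m z0) z0; last first.
    have [|K' K'0 H'] := vanishes_mul p (chi0 (rho *m z0) _ rz).
      by apply: map_f; apply/GL.2.
    exists (K' * c ^+ k), c^-1; split; rewrite ?invr_gt0 ?mulr_ge0 ?exprn_ge0 ?(ltW c0) //.
    move=> w wz; rewrite sub0r nmN; apply: le_trans (pow w _ K'0); apply: H'.
    by apply: (le_trans (near w)); rewrite mulrC -ler_pdivlMr // mul1r ltW.
  exists ((K + K1) * c ^+ k), (Num.min del (Num.min (del / c) c^-1)); split.
  - by rewrite mulr_ge0 ?exprn_ge0 ?addr_ge0 ?(ltW c0).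
  - by rewrite !lt_min del0 divr_gt0 // invr_gt0.
  move=> w; rewrite !lt_min => /and3P[wd wdc wc].
  have rw : l1norm (rho *m w - z0) < del.
    by have := near w; rewrite rz => h; apply: le_lt_trans h _; rewrite mulrC -ltr_pdivlMr.
  have rw1 : l1norm (rho *m w - z0) <= 1.
    have := near w; rewrite rz => h; apply: le_trans h _.
    by rewrite mulrC -ler_pdivlMr // mul1r ltW.
  have [_ Ow] : True /\ Omega w by split => //; case: (Hp w wd).
  have [_ _ _ GV] := GG.
  have fE : f w = f (rho *m w).
    have [Gu _ _ _] := GG.
    by have := finv (invmx rho) w (GV _ Gr) Ow; rewrite invmxK.
  apply: le_trans (pow w (K + K1) (addr_ge0 K0 K10)); rewrite rz fE mulrDl.
  have -> : f (rho *m w) - poly_fun p1 (rho *m w) =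
     (f (rho *m w) - poly_fun p (rho *m w)) + poly_fun ((1 - chi) * p) (rho *m w).
    by rewrite /p1 !poly_funM poly_funB poly_fun1; ring.
  apply: (le_trans (nmD _ _)); apply: lerD; last exact: H1.
  by case: (Hp _ rw).
have sum (s : seq 'M[C]_n) : {subset s <= L} -> exists K' d', [/\ 0 <= K', 0 < d' & forall w,
    l1norm (w - z0) < d' ->
    nm ((count (fun rho => rho *m z0 == z0) s)%:R * f w
      - \sum_(rho <- s) poly_fun p1 (rho *m w)) <= K' * l1norm (w - z0) ^+ k].
  elim: s => [_|rho s IH sL].
    by exists 0, 1; split => // w _; rewrite big_nil mul0r subrr nm0 mul0r.
  have [|Ks [ds [Ks0 ds0 Hs]]] := IH; first by move=> x xs; apply: sL; rewrite inE xs orbT.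
  have [|Kr [dr [Kr0 dr0 Hr]]] := each rho; first by apply/GL.2/sL/mem_head.
  exists (Kr + Ks), (Num.min dr ds); split; rewrite ?addr_ge0 ?lt_min ?dr0 //.
  move=> w; rewrite lt_min => /andP[/Hr hr /Hs hs]; rewrite big_cons /=.
  rewrite mulrDl; apply: le_trans (lerD hr hs); apply: le_trans (nmD _ _).
  rewrite natrD mulrDl opprD addrACA le_eqVlt; apply/orP; left; apply/eqP.
  by congr (nm (_ - _ + _)); case: eqP => _; rewrite ?mul1r ?mul0r.
have [//|Ks [ds [Ks0 ds0 Hs]]] := sum L.
pose Q : mpol := mcst n (m%:R)^-1 * \sum_(rho <- L) affine_comp rho 0 p1.
have QE w : poly_fun Q w = (m%:R)^-1 * \sum_(rho <- L) poly_fun p1 (rho *m w).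
  rewrite poly_funM poly_fun_mcst poly_fun_sum; congr (_ * _).
  by apply: eq_bigr => rho _; rewrite poly_fun_affine addr0.
exists Q, Ks, (Num.min del ds); split => //.
- move=> sigma w Gs _; rewrite !QE; congr (_ * _).
  exact: (invariant_big GG GL _ (fun y => poly_fun p1 y)).
- by rewrite lt_min del0.
move=> w; rewrite lt_min => /andP[/Hp[Ow _] /Hs hs]; split => //.
have mn : (m%:R : C) != 0 by rewrite pnatr_eq0 -lt0n.
have -> : f w - poly_fun Q w = (m%:R)^-1 * (m%:R * f w - \sum_(rho <- L) poly_fun p1 (rho *m w)).
  by rewrite QE mulrBr mulKf.
rewrite nmM nmV nm_nat; apply: le_trans hs; rewrite ler_piMl ?nm_ge0 //.
by rewrite invf_le1 ?ler1n ?ltr0n.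
Qed.

End LocalApproximation.

(** * Descent to the quotient *)

Lemma l1norm_le_norm (R : realType) (n : nat) (h : 'cV[R[i]]_n) (r : R) :
  `|h| = r%:C -> l1norm h <= n%:R * r.
Proof.
move=> hr; apply: (@le_trans _ _ (\sum_(i < n) r)).
  by apply: ler_sum => i _; rewrite -lecR -normE -hr col_norm_coord.
by rewrite sumr_const card_ord mulr_natl.
Qed.

Theorem mainTheorem3 (R : realType) (n : nat) (G : set 'M[R[i]]_n)
    (theta : n.-tuple (mpoly.mpoly n R[i])) (Omega : set 'cV[R[i]]_n) :
  finite_pseudoreflection_group G ->
  hsop G theta ->
  domain Omega ->
  invariant_set G Omega ->
  forall f : 'cV[R[i]]_n -> R[i],
    holomorphic_on Omega f ->
    invariant_fun G Omega f ->
    exists g : 'cV[R[i]]_n -> R[i],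
      [/\ holomorphic_on (poly_map theta @` Omega) g,
          forall z, Omega z -> f z = g (poly_map theta z)
        & forall h : 'cV[R[i]]_n -> R[i],
            holomorphic_on (poly_map theta @` Omega) h ->
            (forall z, Omega z -> f z = h (poly_map theta z)) ->
            forall w, (poly_map theta @` Omega) w -> h w = g w].
Proof.
move=> Gfin Gtheta dom _ f fh finv.
have [GG [L GL]] := reflection_group_enum Gfin.
have [Gu _ _ GV] := GG.
pose lift w := xget 0 [set z | Omega z /\ poly_map theta z = w].
pose g w := f (lift w).
have gE z : Omega z -> f z = g (poly_map theta z).
  move=> Oz; have [Ol tl] : Omega (lift (poly_map theta z)) /\
      poly_map theta (lift (poly_map theta z)) = poly_map theta z.
    exact: (xgetI 0 (P := [set y | Omega y /\ poly_map theta y = poly_map theta z]) (x := z)).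
  rewrite /g; move: (lift _) Ol tl => y Oy /esym/(orbit_map_separates GG GL Gtheta)[rho Gr ->].
  by have := finv (invmx rho) z (GV _ Gr) Oz; rewrite invmxK.
exists g; split => // [|h _ hE w [z Oz <-]]; last by rewrite -hE // gE.
apply: holomorphic_of_contact => _ [z0 Oz0 <-].
set w0 := poly_map theta z0; pose N := size L.
(* [|z - z0| ^ N] is at most a multiple of [|w - w0|], so that an error of order
   [2 N] in [z] is quadratic in [w]. *)
have [p [K [del [pinv K0 del0 Hp]]]] :=
  invariant_poly_approx (2 * N) GG GL dom fh finv Oz0.
have [q qE] := invariant_comp Gtheta pinv.
have [K' K'0 HK'] := orbit_map_hoelder GG GL Gtheta z0.
have n0 : 0 <= n%:R :> R by [].
have A0 : 0 < (K' + 1) * (n%:R + 1) by rewrite mulr_gt0 //; lra.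
pose B := (K' + 1) * (n%:R + 1).
pose r := Num.min (n%:R + 1)^-1 (del ^+ N / B).
have r0 : 0 < r.
  by rewrite lt_min invr_gt0 divr_gt0 ?exprn_gt0 // ltr_wpDl.
exists q, (K * B ^+ 2)%:C, r%:C; split.
- by rewrite ler0c mulr_ge0 ?exprn_ge0 // ltW.
- by rewrite ltcR.
move=> h hr; set w := h + w0.
have [s hs] : exists s : R, `|h| = s%:C.
  by exists (Re `|h|); rewrite RRe_real // normr_real.
have s0 : 0 <= s by rewrite -ler0c -hs.
have sr : s < r by rewrite -ltcR -hs.
have [s1 s2] : s < (n%:R + 1)^-1 /\ s < del ^+ N / B.
  by move: sr; rewrite lt_min => /andP[].
have hl : l1norm h <= n%:R * s := l1norm_le_norm hs.
have [z1 z1w] := orbit_map_surjective GG GL Gtheta w.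
have wh : poly_map theta z1 - w0 = h by rewrite z1w /w addrK.
have [|rho Gr le] := HK' z1.
  rewrite -/w0 wh; apply: (le_trans hl).
  move: s1; rewrite -[_^-1]mul1r ltr_pdivlMr; [|lra]; rewrite mulrDr mulr1; lra.
rewrite -/w0 wh -/N in le.
pose z := rho *m z1.
have tz : poly_map theta z = w by rewrite (poly_map_invariant GG Gtheta z1 Gr).
have dE : l1norm (z0 - z) = l1norm (z - z0).
  by rewrite !l1normB; apply: eq_bigr => i _; rewrite nm_distC.
have le2 : l1norm (z - z0) ^+ N <= B * s.
  rewrite -dE; apply: (le_trans le); apply: (@le_trans _ _ (K' * (n%:R * s))).
    by rewrite ler_wpM2l.
  rewrite /B mulrA ler_wpM2r //; apply: ler_pM => //; lra.
have zd : l1norm (z - z0) < del.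
  rewrite ltNge; apply/negP => ge.
  have : del ^+ N <= B * s.
    by apply: le_trans le2; rewrite lerXn2r ?nnegrE ?l1norm_ge0 // ltW.
  by rewrite leNgt mulrC -ltr_pdivlMr ?s2.
have [Oz fz] := Hp z zd.
have -> : g w - poly_fun q w = f z - poly_fun p z.
  by rewrite qE (gE z Oz) tz.
rewrite normE hs -(rmorphXn (real_complex R)) -(rmorphM (real_complex R)) lecR.
apply: (le_trans fz); rewrite -mulrA ler_wpM2l // -exprMn mulnC exprM.
by rewrite lerXn2r ?nnegrE ?exprn_ge0 ?l1norm_ge0 // mulr_ge0 // ltW.
Qed.
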